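(* Let $(M,g)$ be a Riemannian manifold endowed with a Poisson tensor $\pi$ such that $\mathcal D\pi=0$, where $\mathcal D$ is the metric contravariant connection associated to $(\pi,g)$. Then $\pi$ is a Killing-Poisson tensor on $(M,g)$.
   Context: All objects are smooth. A Poisson tensor on $M$ is a bivector field $\pi\in\Gamma(\wedge^2TM)$ with $[\pi,\pi]=0$ (Schouten-Nijenhuis bracket). Its anchor $\pi_\#:T^*M\to TM$ is defined by $\beta(\pi_\#(\alpha))=\pi(\alpha,\beta)$, and its Koszul bracket on $\Omega^1(M)$ by $[\alpha,\beta]_\pi=L_{\pi_\#(\alpha)}\beta-L_{\pi_\#(\beta)}\alpha-d(\pi(\alpha,\beta))$. A function $f$ on an open set is a Casimir function if $\pi_\#(df)=0$. Let $\langle\cdot,\cdot\rangle$ be the metric induced by $g$ on covectors. The metric contravariant connection $\mathcal D:\Omega^1(M)\times\Omega^1(M)\to\Omega^1(M)$ associated to $(\pi,g)$ is the unique map, $C^\infty(M)$-linear in the first argument, $\mathbb R$-linear in the second, satisfying $\mathcal D_\alpha(f\beta)=f\mathcal D_\alpha\beta+\pi_\#(\alpha)(f)\beta$, $\pi_\#(\alpha).\langle\beta,\gamma\rangle=\langle\mathcal D_\alpha\beta,\gamma\rangle+\langle\beta,\mathcal D_\alpha\gamma\rangle$, and $\mathcal D_\alpha\beta-\mathcal D_\beta\alpha=[\alpha,\beta]_\pi$. The condition $\mathcal D\pi=0$ means $\pi_\#(\alpha).\pi(\beta,\gamma)=\pi(\mathcal D_\alpha\beta,\gamma)+\pi(\beta,\mathcal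 D_\alpha\gamma)$ for all $\alpha,\beta,\gamma\in\Omega^1(M)$. A Poisson tensor $\pi$ on $(M,g)$ is a Killing-Poisson tensor if (i) the divergence of $\pi$ with respect to the Levi-Civita connection $\nabla$ (the vector field obtained by contracting $\nabla\pi$) vanishes, and (ii) for any open set $U\subset M$ and any Casimir function $f\in C^\infty(U)$, $L_{\nabla f}\pi=0$, where $\nabla f$ is the gradient of $f$. *)

(* Defs.v *)
(* Smooth manifolds, Riemannian metrics and Poisson tensors, over the real
   numbers of MathComp-Analysis. *)
From HB Require Import structures.
From mathcomp Require Import all_boot all_order all_algebra.
From mathcomp Require Import all_classical all_reals all_analysis.

Set Implicit Arguments.
Unset Strict Implicit.
Unset Printing Implicit Defensive.

Import Order.TTheory GRing.Theory Num.Theory.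
Import numFieldNormedType.Exports.

Local Open Scope classical_set_scope.
Local Open Scope ring_scope.

Section smooth_functions.
Variables (R : realType) (n : nat).

Definition partial (i : 'I_n) (f : 'rV[R]_n -> R) : 'rV[R]_n -> R :=
  fun x => 'D_(delta_mx 0 i) (f : 'rV[R]_n -> R^o) x.

Definition partials (s : seq 'I_n) (f : 'rV[R]_n -> R) : 'rV[R]_n -> R :=
  foldr partial f s.

(* f is of class C^oo on the open set O: all its iterated partial derivatives
   exist and are continuous on O. *)
Definition smooth_on (O : set 'rV[R]_n) (f : 'rV[R]_n -> R) : Prop :=
  forall (s : seq 'I_n) (x : 'rV[R]_n), O x ->
    {for x, continuous (partials s f)} /\
    (forall i : 'I_n,
       derivable (partials s f : 'rV[R]_n -> R^o) x (delta_mx 0 i)).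

Definition smooth_mx_on (k l : nat) (O : set 'rV[R]_n)
    (A : 'rV[R]_n -> 'M[R]_(k, l)) : Prop :=
  forall i j, smooth_on O (fun x => A x i j).

End smooth_functions.

(* The maps [cmap] and [cinv] are total; only their restrictions to [cdom] and
   [cimg] are meaningful. *)
Record chart (R : realType) (n : nat) (T : topologicalType) := Chart {
  cdom : set T;
  cimg : set 'rV[R]_n;
  cmap : T -> 'rV[R]_n;
  cinv : 'rV[R]_n -> T;
  cdom_open : open cdom;
  cimg_open : open cimg;
  cmap_img : forall p, cdom p -> cimg (cmap p);
  cinv_dom : forall x, cimg x -> cdom (cinv x);
  cmapK : forall p, cdom p -> cinv (cmap p) = p;
  cinvK : forall x, cimg x -> cmap (cinv x) = x;
  cmap_continuous : forall p, cdom p -> {for p, continuous cmap};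
  cinv_continuous : forall x, cimg x -> {for x, continuous cinv} }.

(* The atlas need not be maximal. Besides the atlas, the structure fixes for
   every point p a chart of the atlas around p. *)
Record manifold (R : realType) (n : nat) := Manifold {
  point :> topologicalType;
  manifold_hausdorff : hausdorff_space point;
  manifold_second_countable : @second_countable point;
  atlas : set (chart R n point);
  chart_at : point -> chart R n point;
  chart_at_atlas : forall p, atlas (chart_at p);
  chart_at_dom : forall p, cdom (chart_at p) p;
  atlas_smooth : forall c c', atlas c -> atlas c' ->
    smooth_mx_on (cimg c `&` cinv c @^-1` cdom c') (cmap c' \o cinv c) }.

Section tensor_fields.
Variables (R : realType) (n : nat) (M : manifold R n).

(* The tangent space at p is identified with R^n by means of the coordinates
   of [chart_at p]: a tensor field is a function on M whose value at p is the
   array of the components, in [chart_at p], of the tensor at p. Since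
   [chart_at] is arbitrary, such a function is smooth when its components in
   every chart of the atlas (the functions [vcomp], [fcomp], [mcomp], [bcomp]
   below, obtained by the transformation laws of tensors) are smooth. *)
Definition vector_field := M -> 'rV[R]_n.
Definition covector_field := M -> 'rV[R]_n.
Definition metric_field := M -> 'M[R]_n.
Definition bivector_field := M -> 'M[R]_n.

(* Entry (i, j) is the i-th partial derivative, at p, of the j-th coordinate of
   c' as a function of the coordinates of c. *)
Definition transition_jacobian (c c' : chart R n M) (p : M) : 'M[R]_n :=
  'J (cmap c' \o cinv c) (cmap c p).

Definition vcomp (c : chart R n M) (X : vector_field) (x : 'rV[R]_n)
    : 'rV[R]_n :=
  let p := cinv c x in X p *m transition_jacobian (chart_at p) c p.

Definition fcomp (c : chart R n M) (al : covector_field) (x : 'rV[R]_n)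
    : 'rV[R]_n :=
  let p := cinv c x in al p *m (transition_jacobian c (chart_at p) p)^T.

Definition mcomp (c : chart R n M) (g : metric_field) (x : 'rV[R]_n)
    : 'M[R]_n :=
  let p := cinv c x in let J := transition_jacobian c (chart_at p) p in
  J *m g p *m J^T.

Definition bcomp (c : chart R n M) (P : bivector_field) (x : 'rV[R]_n)
    : 'M[R]_n :=
  let p := cinv c x in let J := transition_jacobian (chart_at p) c p in
  J^T *m P p *m J.

Definition smooth_function (U : set M) (f : M -> R) : Prop :=
  forall c, atlas c -> smooth_on (cimg c `&` cinv c @^-1` U) (f \o cinv c).

Definition smooth_one_form (al : covector_field) : Prop :=
  forall c, atlas c -> smooth_mx_on (cimg c) (fcomp c al).

Definition riemannian_metric (g : metric_field) : Prop :=
  [/\ forall c, atlas c -> smooth_mx_on (cimg c) (mcomp c g),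
      forall p, (g p)^T = g p
    & forall p (v : 'rV[R]_n), v != 0 -> 0 < (v *m g p *m v^T) 0 0].

Definition smooth_bivector_field (P : bivector_field) : Prop :=
  (forall c, atlas c -> smooth_mx_on (cimg c) (bcomp c P)) /\
  (forall p, (P p)^T = - P p).

(* Below, differential operators are evaluated at p in the coordinates of
   [chart_at p]. *)

Definition deriv (X : vector_field) (f : M -> R) : M -> R := fun p =>
  let c := chart_at p in
  'D_(X p) (f \o cinv c : 'rV[R]_n -> R^o) (cmap c p).

Definition differential (f : M -> R) : covector_field := fun p =>
  let c := chart_at p in \row_i partial i (f \o cinv c) (cmap c p).

(* (L_X al)_j = X^i d_i al_j + al_i d_j X^i *)
Definition lie_one_form (X : vector_field) (al : covector_field)
    : covector_field := fun p =>
  let c := chart_at p in let x := cmap c p in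
  'D_(X p) (fcomp c al) x + al p *m ('J (vcomp c X) x)^T.

(* (L_X P)^{ij} = X^k d_k P^{ij} - P^{kj} d_k X^i - P^{ik} d_k X^j *)
Definition lie_bivector (X : vector_field) (P : bivector_field)
    : bivector_field := fun p =>
  let c := chart_at p in let x := cmap c p in let DX := 'J (vcomp c X) x in
  'D_(X p) (bcomp c P) x - DX^T *m P p - P p *m DX.

(* [P, Q]^{ijk} is, up to the global sign on which conventions differ, the sum
   over the cyclic permutations of (i, j, k) of
   P^{li} d_l Q^{jk} + Q^{li} d_l P^{jk}. *)
Definition schouten (P Q : bivector_field) (p : M) (i j k : 'I_n) : R :=
  let c := chart_at p in let x := cmap c p in
  let d (S : bivector_field) l a b :=
    partial l (fun y => bcomp c S y a b) x in
  let t a b e :=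
    \sum_(l < n) (P p l a * d Q l b e + Q p l a * d P l b e) in
  t i j k + t j k i + t k i j.

Definition poisson_tensor (P : bivector_field) : Prop :=
  smooth_bivector_field P /\ forall p i j k, schouten P P p i j k = 0.

Definition bivector_pairing (P : bivector_field) (al be : covector_field)
    : M -> R :=
  fun p => (al p *m P p *m (be p)^T) 0 0.

(* be (P_# al) = P (al, be) *)
Definition anchor (P : bivector_field) (al : covector_field) : vector_field :=
  fun p => al p *m P p.

Definition koszul_bracket (P : bivector_field) (al be : covector_field)
    : covector_field := fun p =>
  lie_one_form (anchor P al) be p - lie_one_form (anchor P be) al p
  - differential (bivector_pairing P al be) p.

Definition cometric (g : metric_field) (al be : covector_field) : M -> R :=
  fun p => (al p *m invmx (g p) *m (be p)^T) 0 0.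

Definition addf (al be : covector_field) : covector_field :=
  fun p => al p + be p.

Definition scalef (f : M -> R) (al : covector_field) : covector_field :=
  fun p => f p *: al p.

(* D is only specified on, and only maps to, the smooth one-forms. *)
Record metric_contravariant_connection (P : bivector_field) (g : metric_field)
    (D : covector_field -> covector_field -> covector_field) : Prop := {
  mcc_smooth : forall al be, smooth_one_form al -> smooth_one_form be ->
    smooth_one_form (D al be);
  mcc_addl : forall al al' be,
    smooth_one_form al -> smooth_one_form al' -> smooth_one_form be ->
    D (addf al al') be = addf (D al be) (D al' be);
  mcc_scalel : forall f al be, smooth_function setT f ->
    smooth_one_form al -> smooth_one_form be ->
    D (scalef f al) be = scalef f (D al be);
  mcc_addr : forall al be be',
    smooth_one_form al -> smooth_one_form be -> smooth_one_form be' ->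
    D al (addf be be') = addf (D al be) (D al be');
  mcc_scaler : forall (a : R) al be,
    smooth_one_form al -> smooth_one_form be ->
    D al (scalef (cst a) be) = scalef (cst a) (D al be);
  mcc_leibniz : forall f al be, smooth_function setT f ->
    smooth_one_form al -> smooth_one_form be ->
    D al (scalef f be) =
    addf (scalef f (D al be)) (scalef (deriv (anchor P al) f) be);
  mcc_metric : forall al be ga,
    smooth_one_form al -> smooth_one_form be -> smooth_one_form ga ->
    forall p, deriv (anchor P al) (cometric g be ga) p =
      cometric g (D al be) ga p + cometric g be (D al ga) p;
  mcc_torsion_free : forall al be, smooth_one_form al -> smooth_one_form be ->
    forall p, D al be p - D be al p = koszul_bracket P al be p }.

Definition parallel_bivector (P : bivector_field)
    (D : covector_field -> covector_field -> covector_field) : Prop :=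
  forall al be ga,
    smooth_one_form al -> smooth_one_form be -> smooth_one_form ga ->
    forall p, deriv (anchor P al) (bivector_pairing P be ga) p =
      bivector_pairing P (D al be) ga p + bivector_pairing P be (D al ga) p.

(* Gamma^k_{ij}, for the Levi-Civita connection of g *)
Definition christoffel (g : metric_field) (p : M) (k i j : 'I_n) : R :=
  let c := chart_at p in
  let d l a b := partial l (fun y => mcomp c g y a b) (cmap c p) in
  2^-1 * \sum_(l < n) invmx (g p) k l * (d i j l + d j i l - d l i j).

(* (nabla_k P)^{ij} = d_k P^{ij} + Gamma^i_{kl} P^{lj} + Gamma^j_{kl} P^{il} *)
Definition nabla_bivector (g : metric_field) (P : bivector_field) (p : M)
    (k i j : 'I_n) : R :=
  let c := chart_at p in
  partial k (fun y => bcomp c P y i j) (cmap c p)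
  + \sum_(l < n) (christoffel g p i k l * P p l j
                  + christoffel g p j k l * P p i l).

Definition divergence (g : metric_field) (P : bivector_field) : vector_field :=
  fun p => \row_j \sum_(i < n) nabla_bivector g P p i i j.

Definition gradient (g : metric_field) (f : M -> R) : vector_field :=
  fun p => differential f p *m invmx (g p).

Definition casimir_on (P : bivector_field) (U : set M) (f : M -> R) : Prop :=
  smooth_function U f /\ forall p, U p -> anchor P (differential f) p = 0.

Definition killing_poisson (P : bivector_field) (g : metric_field) : Prop :=
  [/\ poisson_tensor P,
      forall p, divergence g P p = 0
    & forall (U : set M) (f : M -> R), open U -> casimir_on P U f ->
      forall p, U p -> lie_bivector (gradient g f) P p = 0].

End tensor_fields.

(* Main.v *)
Require Import Defs.
From HB Require Import structures.
From mathcomp Require Import all_boot all_order all_algebra.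
From mathcomp Require Import all_classical all_reals all_analysis.
From mathcomp Require Import ring lra.

Set Implicit Arguments.
Unset Strict Implicit.
Unset Printing Implicit Defensive.

Import Order.TTheory GRing.Theory Num.Theory.

Local Open Scope classical_set_scope.
Local Open Scope ring_scope.

(** Fix a point p and let Gam^{ab}_k be the components of D_{dx^a} dx^b in the
    chart at p. The hypotheses become four identities at p. Torsion-freeness says that the
    derivatives of the bivector are d_k pi^{ab} = Gam^{ab}_k - Gam^{ba}_k;
    compatibility with the metric and parallelism compute the derivatives of
    the cometric and of pi along the image of pi. The fourth identity is the
    derivative of the parallelism identity. Restricted to the kernel K of pi at
    p, where the undifferentiated terms vanish, it reads
    [a, [b, c]] = [D_a b, c] + [b, D_a c], where [a, b] = D_a b - D_b a is the
    bracket of the isotropy Lie algebra K.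

    Everything then follows from linear algebra at p. Combining parallelism and
    absence of torsion cyclically gives pi(D_c a, b) = pi(D_b a, c)
    ([pairing_nabla_swap]): each map x |-> D_x b is infinitesimally symplectic
    for pi, and D preserves K. The same computation with the bracket in place
    of pi gives [D_c a, b] = [D_b a, c] on K ([bracket_nabla_swap]).

    Casimir functions. Let phi = df. The covector phi lies in K, and
    differentiating pi_#(df) = 0 shows that it is central there. Moreover the Lie derivative of pi along
    grad f is, up to sign, (a, b) |-> 2 <D_phi a, b>. The operator D_phi is
    skew for the metric and its image lies in K; on K it takes central values
    and it kills the central vectors in its image, so it is nilpotent and skew,
    hence zero ([central_nabla_eq0], [casimir_gradient_preserves]).

    Divergence. The divergence of pi, paired with b, is the trace of
    x |-> D_x b. The part of the trace on the quotient by K vanishes because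
    that map is infinitesimally symplectic there. The part on K equals
    - <b, h>, where h is the sum of D_y y over an orthonormal basis of K. The
    vector h represents the linear form d |-> tr ad_d on K, and it vanishes
    because x |-> D_x h is at once symmetric and nilpotent on K
    ([trace_nabla_r_eq0], [divergence_eq0]).

    The connection only acts on global one-forms, so the coordinate forms have
    to be extended from a neighbourhood of p. This is done with a bump function
    ([bump_fun], [cutoff_form], [local_frame]). The calculus needed on the way
    is developed from the existence and continuity of partial derivatives: C^1
    functions are differentiable, smooth functions are stable under sums,
    products, inverses and composition, and mixed partials commute. *)

(** * Bilinear forms and the kernel of a bivector *)

Section bilinear_form.
Context {R : comNzRingType} {n : nat}.
Implicit Types (A : 'M[R]_n) (a b c : 'rV[R]_n).

Definition form A a b : R := (a *m A *m b^T) 0 0.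

Lemma formDr A a b c : form A c (a + b) = form A c a + form A c b.
Proof. by rewrite /form linearD mulmxDr mxE. Qed.

Lemma formNl A a b : form A (- a) b = - form A a b.
Proof. by rewrite /form !mulNmx mxE. Qed.

Lemma formNr A a b : form A a (- b) = - form A a b.
Proof. by rewrite /form linearN mulmxN mxE. Qed.

Lemma formBr A a b c : form A c (a - b) = form A c a - form A c b.
Proof. by rewrite formDr formNr. Qed.

Lemma formMD A B a b : form (A + B) a b = form A a b + form B a b.
Proof. by rewrite /form mulmxDr mulmxDl mxE. Qed.

Lemma formMN A a b : form (- A) a b = - form A a b.
Proof. by rewrite /form mulmxN mulNmx mxE. Qed.

Lemma form0l A a : form A 0 a = 0.
Proof. by rewrite /form !mul0mx mxE. Qed.

Lemma form0r A a : form A a 0 = 0.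
Proof. by rewrite /form trmx0 mulmx0 mxE. Qed.

Lemma form_suml A m (F : 'I_m -> 'rV[R]_n) c :
  form A (\sum_i F i) c = \sum_i form A (F i) c.
Proof. by rewrite /form !mulmx_suml summxE. Qed.

Lemma form_tr A a b : form A a b = form A^T b a.
Proof.
by rewrite /form -[in LHS](trmxK (a *m A *m b^T)) mxE !trmx_mul trmxK mulmxA.
Qed.

Lemma form_delta A i j : form A (delta_mx 0 i) (delta_mx 0 j) = A i j.
Proof. by rewrite /form trmx_delta -rowE -colE !mxE. Qed.

Lemma form_delta_r A a j : form A a (delta_mx 0 j) = (a *m A) 0 j.
Proof. by rewrite /form trmx_delta -colE !mxE. Qed.

End bilinear_form.

Lemma mxtrace_sym_anti (R : numDomainType) n (S A : 'M[R]_n) :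
  S^T = S -> A^T = - A -> \tr (S *m A) = 0.
Proof.
move=> Ssym Aanti; have : \tr (S *m A) = - \tr (S *m A).
  by rewrite -[LHS]mxtrace_tr trmx_mul Ssym Aanti mulNmx linearN/= mxtrace_mulC.
by move/eqP; rewrite -addr_eq0 -mulr2n mulrn_eq0 => /eqP.
Qed.

Section kernel.
Context {R : realFieldType} {n : nat} (w G : 'M[R]_n).

(** If V is any generalized inverse of an antisymmetric w, so is - V^T, hence so
    is the antisymmetric part of V. *)
Lemma antisymmetric_generalized_inverse :
  w^T = - w -> exists2 W : 'M[R]_n, W^T = - W & w *m W *m w = w.
Proof.
move=> wanti; pose V := pinvmx w.
have wVw : w *m V *m w = w by rewrite mulmxKpV.
have wVTw : w *m V^T *m w = - w.
  have := congr1 trmx wVw.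
  by rewrite !trmx_mul wanti !mulNmx !mulmxN opprK mulmxA.
exists (2^-1 *: (V - V^T)).
  by rewrite linearZ linearB/= trmxK -scalerN opprB.
rewrite -scalemxAr mulmxBr -scalemxAl mulmxBl wVw wVTw opprK -mulr2n.
by rewrite -scaler_nat scalerA mulVf ?scale1r// pnatr_eq0.
Qed.

(** G *m Y is the G-orthogonal projection onto the row kernel of w: for a basis
    K of the kernel, Y = K^T (K G K^T)^-1 K, which is symmetric. In an
    orthonormal basis y_a of the kernel, Y is the sum of the y_a^T *m y_a. *)
Lemma kernel_orthogonal_projection :
  G^T = G -> (forall a : 'rV[R]_n, a != 0 -> 0 < form G a a) ->
  exists Y : 'M[R]_n, [/\ Y^T = Y, Y *m w = 0 &
    forall m (A : 'M[R]_(m, n)), A *m w = 0 -> A *m G *m Y = A].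
Proof.
move=> Gsym Gpos.
have [K [Kfree Kker]] : exists K : 'M[R]_(\rank (kermx w), n),
    row_free K /\ (K :=: kermx w)%MS.
  by exists (row_base (kermx w)); split; [exact: row_base_free|exact: eq_row_base].
pose Q := K *m G *m K^T.
have Qsym : Q^T = Q by rewrite /Q !trmx_mul trmxK Gsym mulmxA.
have Qu : Q \in unitmx.
  rewrite -row_free_unit -kermx_eq0; apply/eqP; apply/row_matrixP => i; rewrite row0.
  have [//|kn0] := eqVneq (row i (kermx Q)) 0.
  have vQ : row i (kermx Q) *m Q = 0 by rewrite -row_mul mulmx_ker row0.
  set v := row i (kermx Q) in kn0 vQ *.
  have vK0 : v *m K != 0.
    by apply: contraNneq kn0 => vK; rewrite -[v](mulmxKp Kfree) vK mul0mx.
  have := Gpos _ vK0; rewrite /form trmx_mul -!mulmxA mulmxA.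
  by rewrite !mulmxA -(mulmxA v K G) -(mulmxA v (K *m G)) vQ mul0mx mxE ltxx.
have Kw : K *m w = 0 by apply/sub_kermxP; rewrite Kker.
exists (K^T *m invmx Q *m K); split.
- by rewrite !trmx_mul trmxK trmx_inv Qsym mulmxA.
- by rewrite -(mulmxA _ K w) Kw mulmx0.
- move=> m A Aw; have /submxP[B ->] : (A <= K)%MS.
    by rewrite Kker; apply/sub_kermxP.
  rewrite !mulmxA -(mulmxA B) -(mulmxA B).
  by rewrite -[B *m (_ *m _ *m _) *m _]mulmxA mulmxV// mulmx1.
Qed.

End kernel.

(** * Linear algebra of a parallel bivector at a point *)

Section contravariant_symbols.
Context {R : realFieldType} {n : nat} (w G : 'M[R]_n) (Gam : 'I_n -> 'M[R]_n).
Implicit Types (a b c x : 'rV[R]_n).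

(** Covectors are rows, w is the bivector, G the cometric, and row j of Gam i is
    the covector D_{e_i} e_j. Then [nabla a b] is D_a b as a value of the
    extension of D with constant coefficients, [bracket] is the Koszul bracket
    of forms with constant coefficients, and [nabla_r b] is the matrix of
    a |-> D_a b. *)
Definition nabla_mx a : 'M[R]_n := \sum_i a 0 i *: Gam i.
Definition nabla a b : 'rV[R]_n := b *m nabla_mx a.
Definition bracket a b : 'rV[R]_n := nabla a b - nabla b a.
Definition nabla_r b : 'M[R]_n := \matrix_i (b *m Gam i).

Lemma nabla_mxB a b : nabla_mx (a - b) = nabla_mx a - nabla_mx b.
Proof.
by rewrite /nabla_mx -sumrB; apply: eq_bigr => i _; rewrite !mxE scalerBl.
Qed.

Lemma nablaBl a b c : nabla (a - b) c = nabla a c - nabla b c.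
Proof. by rewrite /nabla nabla_mxB mulmxBr. Qed.

Lemma nablaBr a b c : nabla c (a - b) = nabla c a - nabla c b.
Proof. by rewrite /nabla mulmxBl. Qed.

Lemma bracketBl a b c : bracket (a - b) c = bracket a c - bracket b c.
Proof. by rewrite /bracket nablaBl nablaBr; apply/rowP => j; rewrite !mxE; ring. Qed.

Lemma bracketC a b : bracket a b = - bracket b a.
Proof. by rewrite /bracket opprB. Qed.

Lemma bracketBr a b c : bracket c (a - b) = bracket c a - bracket c b.
Proof. by rewrite 3!(bracketC c) bracketBl opprB opprK addrC. Qed.

Lemma nabla0l b : nabla 0 b = 0.
Proof.
by rewrite /nabla /nabla_mx big1 ?mulmx0// => i _; rewrite mxE scale0r.
Qed.

Lemma mul_nabla_r a b : a *m nabla_r b = nabla a b.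
Proof.
rewrite /nabla /nabla_mx mulmx_sumr mulmx_sum_row; apply: eq_bigr => i _.
by rewrite rowK scalemxAr.
Qed.

Hypothesis Gsym : G^T = G.
Hypothesis Gpos : forall a, a != 0 -> 0 < form G a a.
Hypothesis wanti : w^T = - w.
Hypothesis par : forall a b c,
  form w a (bracket b c) = form w (nabla a b) c + form w b (nabla a c).
Hypothesis met : forall a b c, a *m w = 0 ->
  form G (nabla a b) c + form G b (nabla a c) = 0.
Hypothesis der : forall a b c, a *m w = 0 -> b *m w = 0 -> c *m w = 0 ->
  bracket a (bracket b c) = bracket (nabla a b) c + bracket b (nabla a c).

Local Notation ip := (form G).
Local Notation inK a := (a *m w = 0).

(** The hypothesis equates, for each triple, the two expressions that the
    absence of torsion and the invariance of the trilinear map give for one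
    quantity. Summing it over the cyclic permutations of (a, b, c) shows that the
    cyclic sum of T is symmetric; subtracting the instance at (a, b, c) leaves
    the conclusion. *)
Lemma cyclic_swap (T : 'rV[R]_n -> 'rV[R]_n -> 'rV[R]_n -> R) a b c :
  (forall x y z, x \in [:: a; b; c] -> y \in [:: a; b; c] ->
     z \in [:: a; b; c] -> T z y x - T y z x = T x y z - T x z y) ->
  T c a b = T b a c.
Proof.
move=> H.
have h x : x \in [:: x; b; c] by rewrite inE eqxx.
have ha : a \in [:: a; b; c] by rewrite !inE eqxx.
have hb : b \in [:: a; b; c] by rewrite !inE eqxx orbT.
have hc : c \in [:: a; b; c] by rewrite !inE eqxx !orbT.
have := H _ _ _ ha hb hc; have := H _ _ _ hb hc ha; have := H _ _ _ hc ha hb.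
lra.
Qed.

Lemma form_wC a b : form w a b = - form w b a.
Proof. by rewrite form_tr wanti /form mulmxN mulNmx mxE. Qed.

Lemma ipC a b : ip a b = ip b a.
Proof. by rewrite form_tr Gsym. Qed.

Lemma ip_eq0 a : ip a a = 0 -> a = 0.
Proof. by move=> h; apply/eqP; apply: contraTT isT => /Gpos; rewrite h ltxx. Qed.

Lemma metE a b c : inK a -> ip (nabla a b) c = - ip b (nabla a c).
Proof. by move=> Ka; apply/eqP; rewrite -subr_eq0 opprK; apply/eqP/met. Qed.

Lemma form_wK a b : inK a -> form w a b = 0.
Proof. by rewrite /form => ->; rewrite mul0mx mxE. Qed.

Lemma form_wKr a b : inK b -> form w a b = 0.
Proof. by move=> Kb; rewrite form_wC form_wK ?oppr0. Qed.

Lemma inK_form a : (forall b, form w a b = 0) -> inK a.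
Proof. by move=> h; apply/rowP => j; rewrite -form_delta_r h mxE. Qed.

(** Parallelism and the definition of the bracket give two expressions of
    w (x, [y, z]) in terms of w (D_x y, z), which is what [cyclic_swap] compares.
    In other words, x |-> D_x a is infinitesimally symplectic for w. *)
Lemma pairing_nabla_swap a b c :
  form w (nabla c a) b = form w (nabla b a) c.
Proof.
apply: (cyclic_swap (T := fun c a b => form w (nabla c a) b)) => x y z _ _ _.
have := par x y z; rewrite /bracket formBr [form w y _]form_wC.
rewrite (form_wC x (nabla y z)) (form_wC x (nabla z y)); lra.
Qed.

(** Since w (D_a b, c) = w (D_c b, a) by [pairing_nabla_swap]. *)
Lemma inK_nabla a b : inK a -> inK (nabla a b).
Proof.
by move=> Ka; apply: inK_form => c; rewrite pairing_nabla_swap form_wKr.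
Qed.

Lemma inKB a b : inK a -> inK b -> inK (a - b).
Proof. by move=> Ka Kb; rewrite mulmxBl Ka Kb subrr. Qed.

Lemma inK_bracket a b : inK a -> inK b -> inK (bracket a b).
Proof. by move=> Ka Kb; apply: inKB; apply: inK_nabla. Qed.

Lemma bracket_nabla_swap a b c : inK a -> inK b -> inK c ->
  bracket (nabla c a) b = bracket (nabla b a) c.
Proof.
move=> Ka Kb Kc; apply/rowP => j.
apply: (cyclic_swap (T := fun c a b => bracket (nabla c a) b 0 j)) => x y z.
have K t : t \in [:: a; b; c] -> inK t by rewrite !inE => /or3P[] /eqP ->.
move=> /K Kx /K Ky /K Kz; have /rowP/(_ j) := der Kx Ky Kz.
rewrite [bracket y z]/bracket bracketBr (bracketC x (nabla y z)) (bracketC x (nabla z y)).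
rewrite (bracketC y (nabla x z)) !mxE; lra.
Qed.

(** The defect in the Jacobi identity is [D_b a, c] - [D_c a, b], up to sign,
    which vanishes by [bracket_nabla_swap]. *)
Lemma jacobi a b c : inK a -> inK b -> inK c ->
  bracket (bracket a b) c = bracket a (bracket b c) - bracket b (bracket a c).
Proof.
move=> Ka Kb Kc; rewrite der// [bracket a b]/bracket [bracket a c]/bracket bracketBl bracketBr.
rewrite (bracketC b (nabla c a)) (@bracket_nabla_swap a b c)//.
by apply/rowP => j; rewrite !mxE; ring.
Qed.

(** D_phi is skew for the metric, because phi is in the kernel. Put v = D_phi a,
    u = D_phi v and t = D_phi u; they all lie in the kernel. Since phi is central
    and u = D_v phi, the identity [der] makes u central. Then
    <t, t> = <D_u phi, t> = - <phi, D_t u> = <D_t phi, u> = - <t, t>,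
    and skewness propagates t = 0 back to u = 0 and v = 0. *)
Theorem central_nabla_eq0 phi : inK phi -> (forall b, inK b -> bracket phi b = 0) ->
  forall a, nabla phi a = 0.
Proof.
move=> Kphi cent a.
have comm x : inK x -> nabla phi x = nabla x phi.
  by move=> /cent/eqP; rewrite subr_eq0 => /eqP.
pose v := nabla phi a; pose u := nabla phi v; pose t := nabla phi u.
have Kv : inK v by apply: inK_nabla.
have Ku : inK u by apply: inK_nabla.
have Kt : inK t by apply: inK_nabla.
have ucent c : inK c -> bracket u c = 0.
  move=> Kc; have := der Kv Kphi Kc; rewrite !cent// /u ?comm//; last exact: inK_nabla.
  rewrite addr0 => <-; rewrite /bracket nabla0l /nabla mul0mx subrr//.
have t0 : t = 0.
  apply: ip_eq0; have utc : nabla u t = nabla t u.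
    by apply/eqP; rewrite -subr_eq0; apply/eqP/ucent.
  suff : ip t t = - ip t t by move/eqP; rewrite -addr_eq0 -mulr2n mulrn_eq0 => /eqP.
  by rewrite {1}/t comm// metE// utc -metE// -(comm t)// metE.
have u0 : u = 0 by apply: ip_eq0; rewrite {1}/u metE// -/t t0 form0r oppr0.
by apply: ip_eq0; rewrite -/v {1}/v metE// -/u u0 form0r oppr0.
Qed.

(** The trace splits along an arbitrary projection onto the kernel. The
    complementary part is the trace of the product of the symmetric matrix
    [nabla_r b *m w] by an antisymmetric one. By the metric property, the kernel
    part is - <b, h> with h the contraction of D_y y over the kernel. On the
    kernel, <h, d> is the trace of ad_d, so h is orthogonal to all brackets by
    the Jacobi identity; hence V : x |-> D_x h is symmetric and D_h h = 0. From
    [bracket_nabla_swap], D_h (V x) = V (V x); as D_h is skew and V symmetric,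
    this forces V = 0, and <h, h> = - tr V = 0. *)
Theorem trace_nabla_r_eq0 b : \tr (nabla_r b) = 0.
Proof.
have [W Wanti wWw] := antisymmetric_generalized_inverse wanti.
have [Y [Ysym Yw GY]] := kernel_orthogonal_projection w Gsym Gpos.
have inKrow m (A : 'M[R]_(m, n)) i : A *m w = 0 -> inK (row i A).
  by move=> Aw; rewrite -row_mul Aw row0.
have KY i : inK (row i Y) by exact: inKrow.
have rowD m (A : 'M[R]_(m, n)) i x : row i (A *m nabla_r x) = nabla (row i A) x.
  by rewrite row_mul mul_nabla_r.
have Kright m (A : 'M[R]_(m, n)) x : A *m w = 0 -> A *m nabla_r x *m w = 0.
  move=> Aw; apply/row_matrixP => i; rewrite row_mul rowD row0.
  exact/inK_nabla/inKrow.
pose N' := G *m Y.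
have N'w : N' *m w = 0 by rewrite -mulmxA Yw mulmx0.
have GY' m (A : 'M[R]_(m, n)) : A *m w = 0 -> A *m N' = A.
  by move=> /GY; rewrite -mulmxA.
(* The trace of an endomorphism preserving the kernel, restricted to the kernel,
   does not depend on the projection used to compute it; this moves from the
   projection N = 1 - w W to the orthogonal one N' = G Y. *)
have trN' : \tr (nabla_r b) = \tr (N' *m nabla_r b).
  pose N := 1%:M - w *m W.
  have Nw : N *m w = 0 by rewrite mulmxBl mul1mx wWw subrr.
  have KN m (A : 'M[R]_(m, n)) : A *m w = 0 -> A *m N = A.
    by move=> Aw; rewrite mulmxBr mulmx1 mulmxA Aw mul0mx subr0.
  have -> : \tr (nabla_r b) = \tr (nabla_r b *m N).
    rewrite mulmxBr mulmx1 linearB/= mulmxA mxtrace_sym_anti ?subr0//.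
    have E i j : (nabla_r b *m w) i j = form w (nabla (delta_mx 0 i) b) (delta_mx 0 j).
      by rewrite form_delta_r -mul_nabla_r -mulmxA -rowE [RHS]mxE.
    by apply/matrixP => i j; rewrite mxE !E pairing_nabla_swap.
  rewrite mxtrace_mulC -{1}(GY' _ _ Nw) -mulmxA mxtrace_mulC.
  by rewrite (KN _ (N' *m _))// Kright.
pose h := \sum_i nabla (row i Y) (delta_mx 0 i).
have Kh : inK h.
  by rewrite mulmx_suml big1// => i _; apply/inK_nabla/inKrow.
have trh x : \tr (N' *m nabla_r x) = - ip x h.
  rewrite /N' -mulmxA mxtrace_mulC /mxtrace ipC form_suml -sumrN.
  apply: eq_bigr => i _; rewrite metE// opprK ipC.
  by rewrite form_delta_r -rowD -row_mul [RHS]mxE.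
have ad x m (A : 'M[R]_(m, n)) : A *m (nabla_mx x - nabla_r x) = \matrix_i bracket x (row i A).
  by apply/row_matrixP => i; rewrite rowK row_mul mulmxBr mul_nabla_r.
(* The part nabla_mx x of ad_x is skew for the metric and has no trace. *)
have trad x : inK x -> \tr (N' *m (nabla_mx x - nabla_r x)) = ip x h.
  move=> Kx; rewrite mulmxBr linearB/= trh opprK /N' -mulmxA mxtrace_mulC.
  rewrite -mulmxA mxtrace_sym_anti ?add0r//.
  have E i j : (nabla_mx x *m G) i j = form G (nabla x (delta_mx 0 i)) (delta_mx 0 j).
    by rewrite form_delta_r /nabla -mulmxA -rowE [RHS]mxE.
  apply/matrixP => i j; rewrite mxE [RHS]mxE !E metE//.
  by rewrite ipC.
have Kad x m (A : 'M[R]_(m, n)) : inK x -> A *m w = 0 ->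
    A *m (nabla_mx x - nabla_r x) *m w = 0.
  move=> Kx Aw; rewrite ad; apply/row_matrixP => i; rewrite row_mul rowK row0.
  exact/inK_bracket/inKrow.
(* By the Jacobi identity ad_[x, y] is a commutator on the kernel. *)
have h_perp x y : inK x -> inK y -> ip (bracket x y) h = 0.
  move=> Kx Ky; rewrite -trad; last exact: inK_bracket.
  pose A z := nabla_mx z - nabla_r z.
  have -> : N' *m (nabla_mx (bracket x y) - nabla_r (bracket x y)) =
            N' *m A y *m A x - N' *m A x *m A y.
    rewrite /A !ad; apply/row_matrixP => i; rewrite linearB/= !rowK.
    by rewrite jacobi//; exact: inKrow.
  have tr2 z t : inK z -> inK t ->
      \tr (N' *m A z *m A t) = \tr (N' *m A z *m (N' *m A t)).
    by move=> Kz Kt; rewrite [in RHS]mulmxA GY'// Kad.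
  by rewrite linearB/= !tr2// mxtrace_mulC subrr.
have Vsym x y : inK x -> inK y -> ip (nabla x h) y = ip x (nabla y h).
  move=> Kx Ky; rewrite metE// [RHS]ipC metE//; congr (- _).
  by apply/eqP; rewrite -subr_eq0 -formBr ipC h_perp.
have Dhh : nabla h h = 0.
  have Ku := @inK_nabla h h Kh; apply: ip_eq0; set u := nabla h h in Ku *.
  have uh : nabla h u = nabla u h + bracket h u by rewrite addrC subrK.
  have : ip (nabla u h) h = - ip (nabla u h) h by rewrite {1}metE// ipC.
  move/eqP; rewrite -addr_eq0 -mulr2n mulrn_eq0 => /eqP uhh.
  rewrite {1}/u metE// uh formDr ipC uhh ipC h_perp//.
  by rewrite addr0 oppr0.
have Dh x : inK x -> nabla h (nabla x h) = nabla (nabla x h) h.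
  move=> Kx; apply/eqP; rewrite -subr_eq0 -/(bracket _ _) bracketC oppr_eq0.
  rewrite (@bracket_nabla_swap h h x)// Dhh.
  by rewrite /bracket nabla0l /nabla mul0mx subrr.
(* Both computations of <x3, x3>, by the symmetry of V and by the skewness of D_h,
   give <x2, d1>, with opposite signs. *)
have V0 x : inK x -> nabla x h = 0.
  move=> Kx; pose x1 := nabla x h; pose x2 := nabla x1 h; pose x3 := nabla x2 h.
  have K1 : inK x1 by exact: inK_nabla.
  have K2 : inK x2 by exact: inK_nabla.
  have K3 : inK x3 by exact: inK_nabla.
  have x30 : x3 = 0.
    apply: ip_eq0; pose d1 := nabla x3 h.
    have Kd1 : inK d1 by exact: inK_nabla.
    have e1 : ip x3 x3 = ip x2 d1 by rewrite {1}/x3 Vsym.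
    have e2 : ip x2 d1 = - ip x2 d1.
      transitivity (ip x1 (nabla d1 h)); first exact: (Vsym _ _ K1 Kd1).
      rewrite -[nabla d1 h](Dh x3 K3) ipC (metE _ _ Kh) ipC; congr (- ip _ _).
      exact: Dh.
    lra.
  have x20 : x2 = 0.
    by apply: ip_eq0; rewrite {1}/x2 Vsym// -/x3 x30 form0r.
  by apply: ip_eq0; rewrite Vsym// -/x1 -/x2 x20 form0r.
rewrite trN' trh ipC; suff -> : h = 0 by rewrite form0l oppr0.
apply: ip_eq0; rewrite {1}/h form_suml big1// => i _.
by rewrite metE// V0// form0r oppr0.
Qed.

End contravariant_symbols.

(** * Divergence and gradients from first-order data *)

(** The hypotheses are those of the theorem read off in coordinates at one point:
    dw, dG, dg and dGam are the coordinate derivatives of the bivector w, the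
    cometric G, the metric g and the symbols Gam, and ddw m l is the second
    derivative of w. [parallel_deriv] is the derivative of [parallel]. *)
Section one_jet.
Context {R : realFieldType} {n : nat}.
Variables (w G g : 'M[R]_n) (Gam : 'I_n -> 'M[R]_n).
Variables (dw dG dg : 'I_n -> 'M[R]_n).
Variables (ddw dGam : 'I_n -> 'I_n -> 'M[R]_n).
Implicit Types (a b c : 'rV[R]_n).

Hypothesis Gsym : G^T = G.
Hypothesis Gpos : forall a, a != 0 -> 0 < form G a a.
Hypothesis wanti : w^T = - w.
Hypothesis torsion_free : forall k i j, dw k i j = Gam i j k - Gam j i k.
Hypothesis metric : forall i,
  \sum_l w i l *: dG l = Gam i *m G + G *m (Gam i)^T.
Hypothesis parallel : forall i,
  \sum_l w i l *: dw l = Gam i *m w + w *m (Gam i)^T.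
Hypothesis parallel_deriv : forall m i,
  \sum_l (dw m i l *: dw l + w i l *: ddw m l) =
  dGam m i *m w + Gam i *m dw m + (dw m *m (Gam i)^T + w *m (dGam m i)^T).

Lemma form_suml_mx (I : finType) (x : I -> R) (M : I -> 'M[R]_n) b c :
  form (\sum_i x i *: M i) b c = \sum_i x i * form (M i) b c.
Proof.
rewrite /form mulmx_sumr mulmx_suml summxE; apply: eq_bigr => i _.
by rewrite -scalemxAr -scalemxAl mxE.
Qed.

Lemma bracketE a b k : bracket Gam a b 0 k = form (dw k) a b.
Proof.
have E a' b' : nabla Gam a' b' 0 k =
    \sum_i \sum_j a' 0 i * b' 0 j * Gam i j k.
  rewrite /nabla /nabla_mx mulmx_sumr summxE; apply: eq_bigr => i _.
  rewrite -scalemxAr !mxE mulr_sumr; apply: eq_bigr => j _; ring.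
rewrite /bracket mxE [X in _ + X]mxE !E [X in _ - X]exchange_big /= -sumrB.
rewrite /form -mulmxA mxE; apply: eq_bigr => i _.
rewrite -sumrB mxE mulr_sumr; apply: eq_bigr => j _.
rewrite torsion_free mxE; ring.
Qed.

Lemma sum_anchor a (M : 'I_n -> 'M[R]_n) :
  \sum_l (a *m w) 0 l *: M l = \sum_i a 0 i *: \sum_l w i l *: M l.
Proof.
under [RHS]eq_bigr do rewrite scaler_sumr.
rewrite exchange_big; apply: eq_bigr => l _ /=.
by rewrite mxE scaler_suml; apply: eq_bigr => i _; rewrite scalerA.
Qed.

Lemma form_anchor_bracket a b c :
  form (\sum_l (a *m w) 0 l *: dw l) b c = form w a (bracket Gam b c).
Proof.
rewrite form_suml_mx /form [RHS]mxE; apply: eq_bigr => l _.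
by rewrite -/(form (dw l) b c) -bracketE [(bracket _ _ _)^T _ _]mxE.
Qed.

Lemma sum_compat a (S : 'M[R]_n) :
  \sum_i a 0 i *: (Gam i *m S + S *m (Gam i)^T) =
  nabla_mx Gam a *m S + S *m (nabla_mx Gam a)^T.
Proof.
rewrite /nabla_mx mulmx_suml linear_sum mulmx_sumr -big_split/=.
by apply: eq_bigr => i _; rewrite linearZ/= -scalemxAl -scalemxAr scalerDr.
Qed.

Lemma form_compat (A S : 'M[R]_n) b c :
  form (A *m S + S *m A^T) b c = form S (b *m A) c + form S b (c *m A).
Proof.
by rewrite /form mulmxDr mulmxDl mxE trmx_mul !mulmxA.
Qed.

Lemma parallel_form a b c :
  form w a (bracket Gam b c) =
  form w (nabla Gam a b) c + form w b (nabla Gam a c).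
Proof.
rewrite -form_anchor_bracket sum_anchor.
by under eq_bigr do rewrite parallel; rewrite sum_compat form_compat.
Qed.

Lemma metric_form a b c :
  form (\sum_l (a *m w) 0 l *: dG l) b c =
  form G (nabla Gam a b) c + form G b (nabla Gam a c).
Proof.
by rewrite sum_anchor; under eq_bigr do rewrite metric; rewrite sum_compat form_compat.
Qed.

Lemma metric_form_ker a b c : a *m w = 0 ->
  form G (nabla Gam a b) c + form G b (nabla Gam a c) = 0.
Proof.
move=> aw; rewrite -metric_form big1 ?/form ?mulmx0 ?mul0mx ?mxE// => l _.
by rewrite aw mxE scale0r.
Qed.

(** Each undifferentiated w in [parallel_deriv] is contracted with a kernel
    covector, so the second derivatives of w and the derivatives of the symbols
    disappear. *)
Lemma parallel_deriv_form a b c : a *m w = 0 -> b *m w = 0 -> c *m w = 0 ->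
  bracket Gam a (bracket Gam b c) =
  bracket Gam (nabla Gam a b) c + bracket Gam b (nabla Gam a c).
Proof.
move=> aw bw cw; apply/rowP => m; rewrite bracketE [RHS]mxE !bracketE.
have wc : w *m c^T = 0.
  by rewrite -[w]opprK -wanti mulNmx -trmx_mul cw trmx0 oppr0.
transitivity (form (\sum_i a 0 i *: \sum_l (dw m i l *: dw l + w i l *: ddw m l)) b c).
  under eq_bigr do rewrite big_split scalerDr; rewrite big_split /= -sum_anchor.
  rewrite [X in _ + X]big1 ?addr0 => [|l _]; last by rewrite aw mxE scale0r.
  under eq_bigr do rewrite scaler_sumr; rewrite exchange_big /=.
  under eq_bigr do (under eq_bigr do rewrite scalerA; rewrite -scaler_suml).
  rewrite form_suml_mx [LHS]/form [LHS]mxE; apply: eq_bigr => l _.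
  by rewrite -bracketE [(bracket _ _ _)^T _ _]mxE [(a *m _) _ _]mxE.
under eq_bigr do rewrite parallel_deriv.
rewrite form_suml_mx.
have E i : form (dGam m i *m w + Gam i *m dw m + (dw m *m (Gam i)^T + w *m (dGam m i)^T)) b c
  = form (Gam i *m dw m + dw m *m (Gam i)^T) b c.
  rewrite /form !mulmxDr !mulmxDl !mulmxA bw !mul0mx.
  by rewrite -[_ *m w *m _]mulmxA wc mulmx0 add0r addr0.
under eq_bigr do rewrite E.
by rewrite -form_suml_mx sum_compat form_compat.
Qed.

Let trace0 := trace_nabla_r_eq0 Gsym Gpos wanti parallel_form metric_form_ker parallel_deriv_form.
Let central0 := central_nabla_eq0 Gpos wanti parallel_form metric_form_ker parallel_deriv_form.

(** Here phi = df and H is the Hessian of f; the third hypothesis is the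
    derivative of phi *m w = 0 and gives [phi, b] = b w H, so phi is central in
    the kernel. Once D_phi = 0, the pairing of w *m DX with (a, b) is
    <phi, D_a b>, and the three terms of the Lie derivative add up to
    <phi, [a, b] - D_a b + D_b a> = 0. *)
Theorem casimir_gradient_preserves (phi : 'rV[R]_n) (H : 'M[R]_n) :
  phi *m w = 0 -> H^T = H ->
  (forall k, phi *m dw k + row k H *m w = 0) ->
  let DX := \matrix_k (phi *m dG k + row k H *m G) in
  \sum_k (phi *m G) 0 k *: dw k - DX^T *m w - w *m DX = 0.
Proof.
move=> Kphi Hsym dphi DX.
have brk b : bracket Gam phi b = b *m w *m H.
  have e k : phi *m dw k = - (row k H *m w) by apply/eqP; rewrite -addr_eq0 dphi.
  apply/rowP => k; rewrite bracketE /form e mulNmx -!row_mul [LHS]mxE [X in - X]mxE.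
  rewrite -[b *m w *m H]trmxK [RHS]mxE !trmx_mul Hsym wanti.
  by rewrite mulNmx mulmxN [RHS]mxE mulmxA.
have phi0 a : nabla Gam phi a = 0 by apply: central0 => // b bw; rewrite brk bw mul0mx.
have DXE a b : form (w *m DX) a b = form G phi (nabla Gam a b).
  have -> : form (w *m DX) a b = form (\sum_l (a *m w) 0 l *: dG l) phi b
                               + form G (a *m w *m H) b.
    rewrite /form mulmxA -[a *m w *m H *m G]mulmxA.
    have -> : a *m w *m DX = \sum_l (a *m w) 0 l *: (phi *m dG l) + a *m w *m (H *m G).
      rewrite mulmx_sum_row [a *m w *m (H *m G)]mulmx_sum_row -big_split.
      by apply: eq_bigr => l _; rewrite rowK row_mul scalerDr.
    rewrite mulmxDl mxE mulmx_sumr; congr (_ + _); congr ((_ *m _) 0 0).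
    by apply: eq_bigr => l _; rewrite scalemxAr.
  by rewrite metric_form -brk /bracket phi0 sub0r formNl addrAC addrN add0r.
apply/matrixP => i j; rewrite -[LHS]form_delta [RHS]mxE; set a := delta_mx 0 i; set b := delta_mx 0 j.
have -> : form (\sum_k (phi *m G) 0 k *: dw k - DX^T *m w - w *m DX) a b =
    form (\sum_k (phi *m G) 0 k *: dw k) a b + form (w *m DX) b a - form (w *m DX) a b.
  rewrite [form (w *m DX) b a]form_tr trmx_mul wanti mulmxN.
  by rewrite !formMD !formMN.
rewrite !DXE form_suml_mx.
have -> : \sum_k (phi *m G) 0 k * form (dw k) a b = form G phi (bracket Gam a b).
  by rewrite [RHS]/form [RHS]mxE; apply: eq_bigr => k _; rewrite -bracketE [(bracket _ _ _)^T _ _]mxE.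
by rewrite /bracket formBr subrK subrr.
Qed.

Hypothesis gG : g *m G = 1%:M.
Hypothesis dgsym : forall l, (dg l)^T = dg l.
Hypothesis dGE : forall l, dG l = - (G *m dg l *m G).

Let chr k i j :=
  2^-1 * \sum_(l < n) G k l * (dg i j l + dg j i l - dg l i j).

(** The Christoffel symbols enter only through their trace
    chr i i l = (1/2) tr (G dg_l), since the other term contracts a symmetric
    with an antisymmetric array. The metric identity evaluates the resulting sum
    as tr (Gam j), while the absence of torsion gives
    sum_i dw i i j = tr (nabla_r e_j) - tr (Gam j). *)
Theorem divergence_eq0 j :
  \sum_i (dw i i j + \sum_l (chr i i l * w l j + chr j i l * w i l)) = 0.
Proof.
have symE l i k : dg l i k = dg l k i by rewrite -[in LHS]dgsym mxE.
have GE i k : G i k = G k i by rewrite -[in LHS]Gsym mxE.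
have wE i k : w i k = - w k i by have /matrixP/(_ i k) := wanti; rewrite !mxE => ->; rewrite opprK.
have chrtr l : \sum_i chr i i l = 2^-1 * \tr (G *m dg l).
  rewrite /chr -mulr_sumr; congr (_ * _).
  rewrite (eq_bigr (fun i => \sum_m G i m * dg l m i +
      (\sum_m G i m * dg i l m - \sum_m G i m * dg m i l))); last first.
    move=> i _; rewrite -sumrB -big_split; apply: eq_bigr => m _ /=.
    rewrite (symE l m i); ring.
  rewrite big_split sumrB [X in _ - X]exchange_big /=.
  rewrite [X in _ + (_ - X)](eq_bigr (fun i => \sum_m G i m * dg i l m)); last first.
    by move=> i _; apply: eq_bigr => m _; rewrite GE symE.
  by rewrite subrr addr0; apply: eq_bigr => i _; rewrite mxE.
have skew : \sum_i \sum_l chr j i l * w i l = 0.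
  set S := LHS; suff : S = - S by move/eqP; rewrite -addr_eq0 -mulr2n mulrn_eq0 => /eqP.
  rewrite {1}/S exchange_big -sumrN; apply: eq_bigr => i _.
  rewrite -sumrN; apply: eq_bigr => l _ /=; rewrite wE mulrN; congr (- (_ * _)).
  rewrite /chr; congr (_ * _); apply: eq_bigr => m _; rewrite (symE m l i); ring.
have trG l : \tr (G *m dg l) = - \tr (g *m dG l).
  by rewrite dGE mulmxN linearN/= opprK !mulmxA gG mul1mx mxtrace_mulC.
rewrite big_split /=.
under [X in _ + X]eq_bigr do rewrite big_split /=.
rewrite big_split /= skew addr0 [X in _ + X]exchange_big /=.
under [X in _ + X]eq_bigr do rewrite -mulr_suml chrtr trG.
have -> : \sum_l 2^-1 * - \tr (g *m dG l) * w l j = \tr (Gam j).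
  transitivity (2^-1 * \tr (g *m \sum_l w j l *: dG l)).
    rewrite mulmx_sumr linear_sum mulr_sumr; apply: eq_bigr => l _ /=.
    rewrite -scalemxAr linearZ /= (wE l j); ring.
  have Gg : G *m g = 1%:M by apply: mulmx1C.
  rewrite metric mulmxDr linearD/= mxtrace_mulC -(mulmxA _ G g) Gg mulmx1.
  by rewrite (mulmxA g G) gG mul1mx mxtrace_tr; field.
have -> : \sum_i dw i i j = \tr (nabla_r Gam (delta_mx 0 j)) - \tr (Gam j).
  rewrite -sumrB; apply: eq_bigr => i _.
  by rewrite torsion_free mxE -rowE mxE.
by rewrite trace0 sub0r addNr.
Qed.

End one_jet.

(* Only the analysis below views R as a normed module over itself: in the algebra
   above, this structure would make scaler_nat apply to scalars. *)
Import numFieldNormedType.Exports.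

(** * The mean value theorem and C1 functions *)

Section mean_value.
Context {R : realType} {n : nat}.
Implicit Types (f : 'rV[R]_n -> R) (x y e : 'rV[R]_n).

Lemma is_derive_line f y e (c : R) : derivable (f : _ -> R^o) (y + c *: e) e ->
  is_derive c 1 (fun t : R => f (y + t *: e) : R^o) ('D_e (f : _ -> R^o) (y + c *: e)).
Proof.
move=> df.
have E : (fun h : R => h^-1 *: (((fun t : R => f (y + t *: e) : R^o) \o shift c) (h *: 1)
    - f (y + c *: e))) =
    (fun h : R => h^-1 *: (((f : _ -> R^o) \o shift (y + c *: e)) (h *: e) - f (y + c *: e))).
  apply/funext => h /=; rewrite /shift/= [h *: 1]mulr1 scalerDl.
  by rewrite addrCA addrA.
by split; rewrite /derivable/derive E.
Qed.

Lemma mean_value_line f y e (s : R) :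
  (forall c : R, `|c| <= `|s| -> derivable (f : _ -> R^o) (y + c *: e) e) ->
  exists2 c : R, `|c| <= `|s| &
    f (y + s *: e) - f y = s * 'D_e (f : _ -> R^o) (y + c *: e).
Proof.
move=> df; pose g := (fun t : R => f (y + t *: e) : R^o).
pose dg c := 'D_e (f : _ -> R^o) (y + c *: e).
have der (c : R) : `|c| <= `|s| -> is_derive c 1 g (dg c).
  by move=> /df; exact: is_derive_line.
have cont (a b : R) : (forall c, c \in `[a, b] -> `|c| <= `|s|) ->
    {within `[a, b], continuous g}.
  move=> h; apply: derivable_within_continuous => c cab.
  by have [] := der _ (h _ cab).
have g0 : f y = g 0 by rewrite /g scale0r addr0.
rewrite g0; have [s0|s0] := leP 0 s.
  have h c : c \in `[0, s] -> `|c| <= `|s|.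
    by rewrite in_itv /= => /andP[c0 cs]; rewrite !ger0_norm.
  have [|c cs E] := MVT_segment s0 _ (cont _ _ h) (df := dg).
    by move=> c cs; apply/der/h; apply: subset_itv_oo_cc.
  by exists c; [exact: h|rewrite mulrC E subr0].
have h c : c \in `[s, 0] -> `|c| <= `|s|.
  rewrite in_itv /= => /andP[c0 cs].
  by rewrite !ler0_norm ?lerN2 // ltW.
have [|c cs E] := MVT_segment (ltW s0) _ (cont _ _ h) (df := dg).
  by move=> c cs; apply/der/h; apply: subset_itv_oo_cc.
exists c; first exact: h.
rewrite -/(g s) -[LHS]opprB E /dg; ring.
Qed.

End mean_value.

Lemma continuous_big_sum (R : realType) (T : topologicalType) (I : Type)
    (s : seq I) (F : I -> T -> R) (x : T) :
  (forall i, {for x, continuous (F i)}) ->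
  {for x, continuous (fun y => \sum_(i <- s) F i y)}.
Proof.
move=> cF; elim: s => [|i s IH].
  rewrite (_ : (fun _ => _) = cst 0); first exact: cst_continuous.
  by apply/funext => y; rewrite big_nil.
rewrite (_ : (fun _ => _) = fun y => F i y + \sum_(j <- s) F j y).
  by apply: continuousD IH; exact: cF.
by apply/funext => y; rewrite big_cons.
Qed.

Section C1.
Context {R : realType} {n : nat}.
Implicit Types (f : 'rV[R]_n -> R) (O : set 'rV[R]_n) (x y h : 'rV[R]_n).

Lemma row_norm_le x (r : R) : 0 <= r -> (`|x| <= r) <-> forall i, `|x 0 i| <= r.
Proof.
move=> r0; rewrite [`|x|]/Num.Def.normr/= mx_normrE; split=> [H i|H].
  by apply: le_trans H; apply: (le_bigmax _ (fun i => `|x i.1 i.2|) (0, i)).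
by apply: bigmax_le => // -[i j] _ /=; rewrite ord1.
Qed.

Lemma row_entry_norm x i : `|x 0 i| <= `|x|.
Proof. by move: i; apply/row_norm_le. Qed.

(** The vertices of the broken line from 0 to h that follows the coordinate axes. *)
Definition row_trunc (k : nat) h : 'rV[R]_n := \row_i (if (i < k)%N then h 0 i else 0).

Lemma row_truncS (k : 'I_n) h :
  row_trunc k.+1 h = row_trunc k h + h 0 k *: delta_mx 0 k.
Proof.
apply/rowP => i; rewrite !mxE eqxx/= ltnS leq_eqVlt.
case: (eqVneq i k) => [->|ik]; first by rewrite eqxx ltnn add0r mulr1.
by rewrite (_ : (_ == _ :> nat) = false) ?mulr0 ?addr0//; apply/negbTE.
Qed.

Lemma row_trunc_full h : row_trunc n h = h.
Proof. by apply/rowP => i; rewrite mxE ltn_ord. Qed.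

Lemma row_trunc0 h : row_trunc 0 h = 0.
Proof. by apply/rowP => i; rewrite !mxE. Qed.

(** The mean value theorem is applied on each segment of the broken line
    [row_trunc]. *)
Lemma C1_increment f x (r eps : R) :
  (forall y i, `|y - x| <= r -> derivable (f : _ -> R^o) y (delta_mx 0 i) /\
     `|partial i f y - partial i f x| <= eps) ->
  forall h, `|h| <= r ->
    `|f (x + h) - f x - \sum_i h 0 i * partial i f x| <= n%:R * (eps * `|h|).
Proof.
move=> H h hr.
have eps0 (i : 'I_n) : 0 <= eps.
  have [|_] := H x i; first by rewrite subrr normr0 (le_trans _ hr).
  by apply: le_trans.
have step (k : 'I_n) :
    `|f (x + row_trunc k.+1 h) - f (x + row_trunc k h) - h 0 k * partial k f x|
    <= eps * `|h|.
  have near c : `|c| <= `|h 0 k| -> `|x + row_trunc k h + c *: delta_mx 0 k - x| <= r.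
    move=> ch; rewrite addrAC [x + _]addrC addrK; apply/row_norm_le.
      exact: le_trans hr.
    move=> i; rewrite !mxE eqxx /=; case: (eqVneq i k) => [->|ik].
      by rewrite ltnn add0r mulr1 (le_trans ch)// (le_trans (row_entry_norm _ _)).
    rewrite mulr0 addr0; case: ifP => _; last by rewrite normr0 (le_trans _ hr).
    by rewrite (le_trans (row_entry_norm _ _)).
  rewrite row_truncS addrA.
  have [|c ch ->] := @mean_value_line R n f (x + row_trunc k h) (delta_mx 0 k) (h 0 k).
    by move=> c /near /H - /(_ k)[].
  rewrite -mulrBr normrM mulrC ler_pM//; last exact: row_entry_norm.
  by have [_] := H _ k (near _ ch).
have -> : f (x + h) - f x - \sum_i h 0 i * partial i f x =
    \sum_(k < n) (f (x + row_trunc k.+1 h) - f (x + row_trunc k h) - h 0 k * partial k f x).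
  rewrite sumrB; congr (_ - _).
  rewrite -(big_mkord xpredT (fun k => f (x + row_trunc k.+1 h) - f (x + row_trunc k h))).
  by rewrite telescope_sumr// row_trunc_full row_trunc0 addr0.
apply: le_trans (ler_norm_sum _ _ _) _.
apply: le_trans (ler_sum _ (fun i _ => step i)) _.
by rewrite sumr_const card_ord mulr_natl.
Qed.

Lemma C1_differentiable O f x : open O -> O x ->
  (forall y i, O y -> derivable (f : _ -> R^o) y (delta_mx 0 i)) ->
  (forall i, {for x, continuous (partial i f)}) ->
  differentiable (f : _ -> R^o) x.
Proof.
move=> oO Ox df cf.
pose L h : R^o := (h *m \col_i partial i f x) 0 0.
have LE h : L h = \sum_i h 0 i * partial i f x.
  by rewrite /L mxE; apply: eq_bigr => i _; rewrite mxE.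
have Llin : linear L by move=> a u v; rewrite /L mulmxDl -scalemxAl !mxE.
pose LM := GRing.isLinear.Build _ _ _ _ L Llin.
pose LL : {linear 'rV[R]_n -> R^o} := HB.pack L LM.
have Lcont : continuous LL.
  move=> y; rewrite (_ : (LL : _ -> _) = fun h => \sum_i h 0 i * partial i f x).
    apply: continuous_big_sum => i; apply: continuousM; last exact: cst_continuous.
    exact: coord_continuous.
  by apply/funext => h; exact: LE.
pose F : 'rV[R]_n -> R^o := f; rewrite -/F; apply/diff_locallyP.
suff fL : F \o shift x = cst (F x) + LL +o_ (0 : 'rV[R]_n) id.
  by have := diff_unique Lcont fL => dfL; rewrite dfL; split.
apply/eqaddoP => _/posnumP[e].
have e0 : 0 < e%:num / n.+1%:R by rewrite divr_gt0.
have nO : nbhs x O by exact: open_nbhs_nbhs.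
have near1 : \forall y \near x, O y /\ forall i, `|partial i f y - partial i f x| <= e%:num / n.+1%:R.
  near=> y; split; first by near: y.
  near: y; apply: filter_forall => i.
  have /cvgrPdist_le/(_ _ e0) := cf i; apply: filterS => y.
  by rewrite distrC.
have /nbhs_ballP[r /= r0 rH] := near1.
near=> h.
have hr : `|h| <= r / 2.
  near: h; apply/nbhs_ballP; exists (r / 2) => //=; first by rewrite divr_gt0.
  by move=> h; rewrite -ball_normE/= sub0r normrN => /ltW.
have -> : (F \o shift x - (cst (F x) + LL)) h = f (x + h) - f x - \sum_i h 0 i * partial i f x.
  by rewrite -LE opprD addrA [x + h]addrC.
apply: le_trans (@C1_increment f x (r / 2) (e%:num / n.+1%:R) _ h hr) _ => [y i yr|].
  have [|Oy /(_ i)] := rH y.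
    by rewrite -ball_normE /= distrC (le_lt_trans yr)// ltr_pdivrMr// ltr_pMr// ltr1n.
  by split => //; apply: df.
rewrite mulrA ler_wpM2r// mulrCA ler_piMr// ler_pdivrMr// mul1r ler_nat//.
Unshelve. all: by end_near. Qed.

End C1.

(** * Functions of class C^k *)

Lemma continuous_eq_near (T U : topologicalType) (f g : T -> U) (x : T) :
  (\forall y \near x, f y = g y) -> {for x, continuous f} -> {for x, continuous g}.
Proof.
move=> E cf; have fgx := nbhs_singleton E.
rewrite /prop_for /continuous_at -fgx; apply: cvg_trans cf.
by apply: near_eq_cvg; apply: filterS E => y ->.
Qed.

Section Ck.
Context {R : realType} {n : nat}.
Implicit Types (f g : 'rV[R]_n -> R) (O : set 'rV[R]_n) (x y : 'rV[R]_n).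

(** Smoothness quantifies over the iterated partials of one function; the
    recursion on the order turns stability properties into inductions in which
    the function varies. *)
Fixpoint Ck (k : nat) O f : Prop :=
  (forall x, O x -> {for x, continuous f}) /\
  if k is k'.+1 then
    (forall x i, O x -> derivable (f : _ -> R^o) x (delta_mx 0 i)) /\
    (forall i, Ck k' O (partial i f))
  else True.

Lemma smooth_onP O f : smooth_on O f <-> forall k, Ck k O f.
Proof.
split=> [sf k|Cf s].
  elim: k f sf => [|k IH] f sf; split=> //; first by move=> x /(sf [::])[].
    by move=> x /(sf [::])[].
  split=> [x i /(sf [::])[_ /(_ i)]//|i]; apply: IH => s x Ox.
  by have := sf (rcons s i) x Ox; rewrite /partials -cats1 foldr_cat.
elim/last_ind: s f Cf => [|s i IH] f Cf x Ox.
  by have [c [d _]] := Cf 1%N; split => [|i]; [exact: c|exact: d].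
rewrite /partials -cats1 foldr_cat /=; apply: IH => // k.
by have [_ [_]] := Cf k.+1; apply.
Qed.

Lemma Ck_continuous k O f x : Ck k O f -> O x -> {for x, continuous f}.
Proof. by case: k => [|k] [c _]; exact: c. Qed.

Lemma Ck_le k O f : Ck k.+1 O f -> Ck k O f.
Proof.
elim: k f => [|k IH] f [c [d p]]; first by split.
by split=> //; split=> // i; exact/IH/p.
Qed.

Lemma Ck_differentiable k O f x : open O -> Ck k.+1 O f -> O x ->
  differentiable (f : _ -> R^o) x.
Proof.
move=> oO [c [d p]] Ox; apply: (C1_differentiable oO Ox) => [y i|i]; first exact: d.
exact: Ck_continuous (p i) Ox.
Qed.

Lemma smooth_differentiable O f x : open O -> smooth_on O f -> O x ->
  differentiable (f : _ -> R^o) x.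
Proof. by move=> oO /smooth_onP/(_ 1%N); exact: Ck_differentiable. Qed.

Lemma smooth_partial O f i : smooth_on O f -> smooth_on O (partial i f).
Proof.
by move=> /smooth_onP sf; apply/smooth_onP => k; have [_ [_]] := sf k.+1; apply.
Qed.

Lemma partial_eq_near f g x i : (\forall y \near x, f y = g y) ->
  partial i f x = partial i g x.
Proof. by move=> fg; rewrite /partial; apply: near_eq_derive. Qed.

Lemma near_open O x (P : 'rV[R]_n -> Prop) :
  open O -> O x -> (forall y, O y -> P y) -> \forall y \near x, P y.
Proof. by move=> oO Ox OP; apply: filterS (open_nbhs_nbhs (conj oO Ox)). Qed.

Lemma partial_eq_on O f g x i : open O -> O x -> (forall y, O y -> f y = g y) ->
  partial i f x = partial i g x.
Proof. by move=> oO Ox fg; apply: partial_eq_near; exact: near_open fg. Qed.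

Lemma Ck_eq_on k O f g : open O -> (forall x, O x -> f x = g x) ->
  Ck k O f -> Ck k O g.
Proof.
move=> oO; elim: k f g => [|k IH] f g fg [c r].
  by split=> // x Ox; apply: continuous_eq_near (near_open oO Ox fg) (c x Ox).
move: r => [d p]; split; last split.
- by move=> x Ox; apply: continuous_eq_near (near_open oO Ox fg) (c x Ox).
- by move=> x i Ox; apply: near_eq_derivable (d x i Ox); exact: near_open oO Ox fg.
- by move=> i; apply: IH (p i) => x Ox; exact: partial_eq_on fg.
Qed.

Lemma Ck_cst k O (a : R) : Ck k O (cst a).
Proof.
elim: k a => [|k IH] a; first by split=> // x _; exact: cst_continuous.
split=> [x _|]; first exact: cst_continuous.
split=> [x i _|i]; first exact: derivable_cst.
by rewrite (_ : partial i _ = cst 0)//; apply/funext => x; rewrite /partial derive_cst.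
Qed.

Lemma Ck_add k O f g : open O -> Ck k O f -> Ck k O g -> Ck k O (fun x => f x + g x).
Proof.
move=> oO; elim: k f g => [|k IH] f g [cf rf] [cg rg].
  by split=> // x Ox; apply: continuousD; [exact: cf|exact: cg].
move: rf rg => [df pf] [dg pg]; split=> [x Ox|]; last split=> [x i Ox|i].
- by apply: continuousD; [exact: cf|exact: cg].
- by apply: derivableD; [exact: df|exact: dg].
- apply: (Ck_eq_on (f := fun x => partial i f x + partial i g x)) (IH _ _ (pf i) (pg i)) => // x Ox.
  by rewrite [RHS]/partial (deriveD (df x i Ox) (dg x i Ox)).
Qed.

Lemma Ck_mul k O f g : open O -> Ck k O f -> Ck k O g -> Ck k O (fun x => f x * g x).
Proof.
move=> oO; elim: k f g => [|k IH] f g Cf Cg.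
  move: Cf Cg => [cf rf] [cg rg].
  by split=> // x Ox; apply: continuousM; [exact: cf|exact: cg].
have C'f := Ck_le Cf; have C'g := Ck_le Cg.
move: Cf Cg => [cf [df pf]] [cg [dg pg]]; split=> [x Ox|]; last split=> [x i Ox|i].
- by apply: continuousM; [exact: cf|exact: cg].
- by apply: derivableM; [exact: df|exact: dg].
- apply: (Ck_eq_on (f := fun x => f x * partial i g x + g x * partial i f x)) => //.
    by move=> x Ox; rewrite [RHS]/partial (deriveM (df x i Ox) (dg x i Ox)).
  apply: Ck_add => //; [exact: IH C'f (pg i)|exact: IH C'g (pf i)].
Qed.

Lemma Ck_sum k O (I : Type) (s : seq I) (F : I -> 'rV[R]_n -> R) : open O ->
  (forall i, Ck k O (F i)) -> Ck k O (fun x => \sum_(i <- s) F i x).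
Proof.
move=> oO CF; elim: s => [|i s IH].
  by apply: Ck_eq_on (Ck_cst k O 0) => // x _; rewrite big_nil.
by apply: Ck_eq_on (Ck_add oO (CF i) IH) => // x _; rewrite big_cons.
Qed.

Lemma Ck_prod k O (I : Type) (s : seq I) (F : I -> 'rV[R]_n -> R) : open O ->
  (forall i, Ck k O (F i)) -> Ck k O (fun x => \prod_(i <- s) F i x).
Proof.
move=> oO CF; elim: s => [|i s IH].
  by apply: Ck_eq_on (Ck_cst k O 1) => // x _; rewrite big_nil.
by apply: Ck_eq_on (Ck_mul oO (CF i) IH) => // x _; rewrite big_cons.
Qed.

Lemma Ck_inv k O f : open O -> (forall x, O x -> f x != 0) -> Ck k O f ->
  Ck k O (fun x => (f x)^-1).
Proof.
move=> oO f0; elim: k => [|k IH] Cf.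
  by split=> // x Ox; apply: continuousV (f0 x Ox) _; exact: Ck_continuous Cf Ox.
have CV := IH (Ck_le Cf); have [cf [df pf]] := Cf.
split=> [x Ox|]; last split=> [x i Ox|i].
- by apply: continuousV (f0 x Ox) _; exact: cf.
- by apply: derivableV; [exact: f0|exact: df].
- apply: (Ck_eq_on (f := fun x => (-1) * ((f x)^-1 * (f x)^-1) * partial i f x)) => //.
    move=> x Ox; rewrite [RHS]/partial (deriveV (f0 x Ox) (df x i Ox)).
    by rewrite mulN1r -invfM -expr2.
  apply: Ck_mul (pf i) => //; apply: Ck_mul => //; [exact: Ck_cst|exact: Ck_mul].
Qed.

Lemma Ck_coord k O (i : 'I_n) : Ck k O (fun x => x 0 i).
Proof.
have c x : {for x, continuous (fun y : 'rV[R]_n => y 0 i)} by exact: coord_continuous.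
have D x v : differentiable (fun y : 'rV[R]_n => y 0 i : R^o) x by exact: differentiable_coord.
case: k => [|k]; first by split=> // x _; exact: c.
split=> [x _|]; first exact: c.
split=> [x j _|j]; first by apply: diff_derivable; exact: D.
rewrite (_ : partial j (fun y => y 0 i) = cst ((delta_mx 0 j : 'rV[R]_n) 0 i)).
  exact: Ck_cst.
apply/funext => x; rewrite /partial /derive; apply: cvg_lim => //.
apply: cvg_near_cst; near=> h; rewrite /= /shift !mxE addrK scalerA mulVf ?scale1r//.
near: h; exact: nbhs_dnbhs_neq.
Unshelve. all: by end_near. Qed.

End Ck.

Section composition.
Context {R : realType} {m n : nat}.
Implicit Types (f : 'rV[R]_n -> R) (F : 'rV[R]_m -> 'rV[R]_n).

Lemma continuous_row (T : topologicalType) (F : T -> 'rV[R]_n) x :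
  (forall i, {for x, continuous (fun y => F y 0 i)}) -> {for x, continuous F}.
Proof.
move=> cF; apply/cvgrPdist_le => e e0; near=> y.
apply/row_norm_le; first exact: ltW.
near: y; apply: filter_forall => i.
have /cvgrPdist_le/(_ _ e0) := cF i; apply: filterS => y.
by rewrite !mxE.
Unshelve. all: by end_near. Qed.

Lemma differentiable_row F x :
  (forall i, differentiable (fun y => F y 0 i : R^o) x) -> differentiable F x.
Proof.
move=> dF.
rewrite (_ : F = \sum_(i < n) (fun y => F y 0 i *: delta_mx 0 i)).
  by apply: differentiable_sum => i; apply: differentiableZl; exact: dF.
by apply/funext => y; rewrite fct_sumE [LHS]row_sum_delta.
Qed.

Lemma diff_row F x v i : differentiable F x ->
  ('d F x v) 0 i = 'd (fun y => F y 0 i : R^o) x v.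
Proof.
move=> dF; rewrite -!deriveE//; last first.
  exact: (differentiable_comp dF (differentiable_coord _ _ _)).
rewrite derive_mx ?mxE//; exact: diff_derivable.
Qed.

Lemma diff_partial f x v : differentiable (f : _ -> R^o) x ->
  'd (f : _ -> R^o) x v = \sum_i v 0 i * partial i f x.
Proof.
move=> df; rewrite {1}[v]row_sum_delta linear_sum; apply: eq_bigr => i _.
by rewrite linearZ /= /partial deriveE.
Qed.

End composition.

(** * The chain rule and mixed partials *)

Section chain.
Context {R : realType} {m n : nat}.
Implicit Types (f : 'rV[R]_n -> R) (F : 'rV[R]_m -> 'rV[R]_n).

Lemma partial_comp f F x i : differentiable F x ->
  differentiable (f : _ -> R^o) (F x) ->
  partial i (f \o F) x = \sum_j partial j f (F x) * partial i (fun y => F y 0 j) x.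
Proof.
move=> dF df; rewrite /partial deriveE; last exact: differentiable_comp.
rewrite (diff_comp dF df) /= diff_partial//; apply: eq_bigr => j _.
rewrite mulrC diff_row//; congr (_ * _); rewrite deriveE//.
exact: (differentiable_comp dF (differentiable_coord _ _ _)).
Qed.

Lemma Ck_comp k (O : set 'rV[R]_m) (O' : set 'rV[R]_n) f F : open O -> open O' ->
  (forall x, O x -> O' (F x)) -> (forall j, Ck k O (fun x => F x 0 j)) ->
  Ck k O' f -> Ck k O (f \o F).
Proof.
move=> oO oO' FO; elim: k f => [|k IH] f CF Cf.
  split=> // x Ox; apply: continuous_comp.
    by apply: continuous_row => j; exact: Ck_continuous (CF j) Ox.
  exact: Ck_continuous Cf (FO _ Ox).
have dF x : O x -> differentiable F x.
  by move=> Ox; apply: differentiable_row => j; exact: Ck_differentiable (CF j) Ox.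
have df x : O x -> differentiable (f : _ -> R^o) (F x).
  by move=> Ox; apply: Ck_differentiable (Cf) (FO _ Ox).
have dfF x : O x -> differentiable (f \o F : _ -> R^o) x.
  by move=> Ox; apply: differentiable_comp; [exact: dF|exact: df].
split=> [x Ox|]; last split=> [x i Ox|i].
- exact: differentiable_continuous (dfF x Ox).
- exact: diff_derivable (dfF x Ox).
- apply: (Ck_eq_on (f := fun x => \sum_j partial j f (F x) * partial i (fun y => F y 0 j) x)) => //.
    by move=> x Ox; rewrite partial_comp//; [exact: dF|exact: df].
  apply: Ck_sum => // j; apply: Ck_mul => //.
    by apply: (IH (partial j f)) => [l|]; [exact/Ck_le|have [_ [_]] := Cf; apply].
  by have [_ [_]] := CF j; apply.
Qed.

End chain.

Section mixed_partials.
Context {R : realType} {n : nat}.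
Implicit Types (f : 'rV[R]_n -> R) (x : 'rV[R]_n).

Lemma continuous_near_dist f x (e : R) : {for x, continuous f} -> 0 < e ->
  exists2 r : R, 0 < r & forall y, `|y - x| < r -> `|f x - f y| <= e.
Proof.
move=> cf e0; have /cvgrPdist_le/(_ _ e0)/nbhs_ballP[r /= r0 H] := cf.
by exists r => // y yx; apply: H; rewrite -ball_normE /= distrC.
Qed.

Lemma open_near_dist (O : set 'rV[R]_n) x : open O -> O x ->
  exists2 r : R, 0 < r & forall y, `|y - x| < r -> O y.
Proof.
move=> oO Ox; have /nbhs_ballP[r /= r0 H] := open_nbhs_nbhs (conj oO Ox).
by exists r => // y yx; apply: H; rewrite -ball_normE /= distrC.
Qed.

Lemma delta_norm_le (i : 'I_n) (c : R) : `|c *: delta_mx 0 i : 'rV[R]_n| <= `|c|.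
Proof.
rewrite normrZ ler_piMr//; apply/row_norm_le => // j.
by rewrite !mxE eqxx /=; case: (j == i); rewrite ?normr1 ?normr0.
Qed.

(** Two applications of the mean value theorem, to the increment of f along e_j
    and then to its i-th partial. The left-hand side is symmetric in i and j up
    to rearrangement, which is the source of [partialC]. *)
Lemma second_difference f x i j (s : R) :
  (forall y, `|y - x| <= `|s| + `|s| -> derivable (f : _ -> R^o) y (delta_mx 0 i) /\
     derivable (partial i f : _ -> R^o) y (delta_mx 0 j)) ->
  exists2 y, `|y - x| <= `|s| + `|s| &
   f (x + s *: delta_mx 0 i + s *: delta_mx 0 j) - f (x + s *: delta_mx 0 i)
   - (f (x + s *: delta_mx 0 j) - f x) = s * (s * partial j (partial i f) y).
Proof.
move=> H; pose g y := f (y + s *: delta_mx 0 j) - f y.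
have near c c' : `|c| <= `|s| -> `|c'| <= `|s| ->
    `|x + c *: delta_mx 0 i + c' *: delta_mx 0 j - x| <= `|s| + `|s|.
  move=> cs c's; rewrite addrAC [x + _]addrC addrK.
  apply: le_trans (ler_normD _ _) _; apply: lerD.
    by apply: le_trans (delta_norm_le _ _) _.
  by apply: le_trans (delta_norm_le _ _) _.
have near0 c : `|c| <= `|s| -> `|x + c *: delta_mx 0 i - x| <= `|s| + `|s|.
  by move=> cs; have := near c 0 cs; rewrite scale0r addr0 normr0; apply.
have dsh (y v w : 'rV[R]_n) : derivable (f : _ -> R^o) (y + w) v ->
    derivable (fun z => f (z + w) : R^o) y v /\
    'D_v (fun z => f (z + w) : R^o) y = 'D_v (f : _ -> R^o) (y + w).
  move=> d.
  have E : (fun h : R => h^-1 *: (((fun z => f (z + w) : R^o) \o shift y) (h *: v) - f (y + w)))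
         = (fun h : R => h^-1 *: (((f : _ -> R^o) \o shift (y + w)) (h *: v) - f (y + w))).
    by apply/funext => h /=; rewrite /shift /= addrA.
  by rewrite /derivable/derive E.
have dg c : `|c| <= `|s| ->
    derivable (g : _ -> R^o) (x + c *: delta_mx 0 i) (delta_mx 0 i) /\
    partial i g (x + c *: delta_mx 0 i) =
    partial i f (x + c *: delta_mx 0 i + s *: delta_mx 0 j)
    - partial i f (x + c *: delta_mx 0 i).
  move=> cs; have [d1 _] := H _ (near _ _ cs (lexx _)).
  have [d2 _] := H _ (near0 _ cs); have [d3 d3E] := dsh _ _ _ d1.
  split; first exact: (derivableB d3 d2).
  have E := deriveB d3 d2; rewrite d3E in E; exact: E.
have [|c cs E1] := @mean_value_line R n g x (delta_mx 0 i) s.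
  by move=> c /dg[].
have [|c' c's E2] := @mean_value_line R n (partial i f) (x + c *: delta_mx 0 i) (delta_mx 0 j) s.
  by move=> c' c's; have [] := H _ (near _ _ cs c's).
exists (x + c *: delta_mx 0 i + c' *: delta_mx 0 j); first exact: near.
rewrite -/(g (x + s *: delta_mx 0 i)) -/(g x) E1; congr (s * _).
by rewrite -[LHS]/(partial i g _) (dg c cs).2 E2.
Qed.

Lemma partialC O f x i j : open O -> O x -> Ck 2 O f ->
  partial i (partial j f) x = partial j (partial i f) x.
Proof.
move=> oO Ox Cf.
have d1 y k : O y -> derivable (f : _ -> R^o) y (delta_mx 0 k).
  by have [_ [d _]] := Cf; exact: d.
have d2 y k l : O y -> derivable (partial k f : _ -> R^o) y (delta_mx 0 l).
  by have [_ [_ /(_ k)[_ [d _]]]] := Cf; exact: d.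
have c2 k l : {for x, continuous (partial l (partial k f))}.
  by have [_ [_ /(_ k)[_ [_ /(_ l)[c _]]]]] := Cf; exact: c.
apply/eqP; rewrite -subr_eq0 -normr_le0; apply/ler_addgt0Pl => e e0; rewrite addr0.
have e2 : 0 < e / 2 by rewrite divr_gt0.
have [r1 r10 N1] := continuous_near_dist (c2 j i) e2.
have [r2 r20 N2] := continuous_near_dist (c2 i j) e2.
have [r3 r30 N3] := open_near_dist oO Ox.
pose s := Num.min r1 (Num.min r2 r3) / 4.
have m0 : 0 < Num.min r1 (Num.min r2 r3) by rewrite !lt_min r10 r20.
have s0 : 0 < s by rewrite divr_gt0.
have inb y : `|y - x| <= `|s| + `|s| -> [/\ `|y - x| < r1, `|y - x| < r2 & `|y - x| < r3].
  move=> h; have : `|y - x| < Num.min r1 (Num.min r2 r3).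
    by rewrite (le_lt_trans h)// gtr0_norm// /s; lra.
  by rewrite !lt_min => /and3P[].
have H k l y : `|y - x| <= `|s| + `|s| -> derivable (f : _ -> R^o) y (delta_mx 0 k) /\
    derivable (partial k f : _ -> R^o) y (delta_mx 0 l).
  by move=> /inb[_ _ /N3 Oy]; split; [exact: d1|exact: d2].
have [y1 /inb[_ /N2 h1 _] E1] := second_difference (H i j).
have [y2 /inb[/N1 h2 _ _] E2] := second_difference (H j i).
have exch : x + s *: delta_mx 0 j + s *: delta_mx 0 i =
  x + s *: delta_mx 0 i + s *: delta_mx 0 j by exact: addrAC.
have E : partial j (partial i f) y1 = partial i (partial j f) y2.
  apply: (@mulfI _ s); first by rewrite gt_eqF.
  apply: (@mulfI _ s); first by rewrite gt_eqF.
  apply: etrans (esym E1) (etrans _ E2); rewrite exch.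
  move: (f (x + s *: delta_mx 0 i + s *: delta_mx 0 j)) (f (x + s *: delta_mx 0 i)).
  by move: (f (x + s *: delta_mx 0 j)) (f x) => a b c d; ring.
move: h1 h2; rewrite E.
move: (partial i (partial j f) x) (partial j (partial i f) x) (partial i (partial j f) y2).
move=> A B C hB hA; rewrite (_ : A - B = (A - C) - (B - C)); last by ring.
by apply: le_trans (ler_normB _ _) _; rewrite [leRHS]splitr; apply: lerD.
Qed.

End mixed_partials.

(** * Bump functions *)

Section flat_exp.
Context {R : realType}.
Implicit Types (x : R) (m : nat).

(** The family x^-m exp (-1/x), extended by 0, is closed under differentiation
    up to linear combinations ([is_derive_flat_exp]); this gives smoothness
    without describing the higher derivatives of exp (-1/x). *)
Definition flat_exp m x : R := if 0 < x then x^-1 ^+ m * expR (- x^-1) else 0.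

Lemma flat_exp_pos m x : 0 < x -> 0 < flat_exp m x.
Proof. by move=> x0; rewrite /flat_exp x0 mulr_gt0 ?expR_gt0// exprn_gt0// invr_gt0. Qed.

Lemma flat_exp_nonpos m x : x <= 0 -> flat_exp m x = 0.
Proof. by move=> x0; rewrite /flat_exp ltNge x0. Qed.

(** With t = 1/x this is t^{m+1} <= (m+1)! exp t. *)
Lemma flat_exp_le m x : `|flat_exp m x| <= m.+1`!%:R * `|x|.
Proof.
rewrite /flat_exp; case: ifPn => [x0|_]; last by rewrite normr0 mulr_ge0.
rewrite !gtr0_norm//; last by rewrite mulr_gt0 ?expR_gt0// exprn_gt0// invr_gt0.
have t0 : 0 < x^-1 by rewrite invr_gt0.
have := expR_ge1Dxn m (ltW t0); rewrite expRN; set t := x^-1 in t0 *.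
have -> : x = t^-1 by rewrite invrK.
move=> h; have f0 : (0 : R) < m.+1`!%:R by rewrite ltr0n fact_gt0.
rewrite ler_pdivrMr ?expR_gt0// mulrAC ler_pdivlMr// -exprSr.
rewrite mulrC -ler_pdivrMr//; apply: le_trans h; lra.
Qed.

Lemma flat_exp_factor m x : flat_exp m x = x * flat_exp m.+1 x.
Proof.
rewrite /flat_exp; case: ifPn => [x0|_]; last by rewrite mulr0.
by rewrite exprS !mulrA mulfV ?mul1r// gt_eqF.
Qed.

Lemma is_derive_flat_exp m x :
  is_derive x 1 (flat_exp m) (flat_exp m.+2 x - m%:R * flat_exp m.+1 x).
Proof.
have [x0|x0|x0] := ltgtP x 0.
- rewrite !flat_exp_nonpos ?ltW// mulr0 subr0.
  have near0 : \near x, cst 0 x = flat_exp m x.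
    near=> y; rewrite flat_exp_nonpos//; apply: ltW.
    by near: y; exact: lt_nbhsl.
  exact: near_eq_is_derive near0 (is_derive_cst (0 : R) x (1 : R)).
- have xn0 : x != 0 by rewrite gt_eqF.
  have nearE : \near x, x^-1 ^+ m * expR (- x^-1) = flat_exp m x.
    near=> y; rewrite /flat_exp ifT//.
    by near: y; exact: lt_nbhsr.
  apply: near_eq_is_derive nearE _.
  have dV : is_derive x (1 : R) (fun y : R => y^-1) (- x^-2).
    have d1 := @derivable_id R R x 1.
    split; first exact: (@derivableV R R id x 1 xn0 d1).
    rewrite (@deriveV R R id x 1 xn0 d1) derive_id.
    exact: mulr1.
  have dN : is_derive x (1 : R) (fun y : R => - y^-1) (x^-2).
    by have := is_deriveN dV; rewrite opprK.
  have dE := @is_derive1_comp R expR (fun y => - y^-1) x _ _ (is_derive_expR (- x^-1)) dN.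
  have dX := is_deriveX m dV.
  have -> : (fun y : R => y^-1 ^+ m * expR (- y^-1)) =
      ((fun y : R => y^-1) ^+ m) * (expR \o (fun y => - y^-1)).
    by apply/funext => y; rewrite exprfctE.
  apply: is_derive_eq (is_deriveM dX dE) _.
  rewrite /flat_exp x0 /GRing.scale /= exprVn.
  rewrite exprfctE -!exprVn; move: (x^-1) (expR _) => t E.
  case: (m) => [|k]; rewrite /= !exprS; last by ring.
  by rewrite !expr0; ring.
(* At 0 the difference quotient is flat_exp m.+1, which is small by flat_exp_le. *)
- rewrite x0 !flat_exp_nonpos// mulr0 subr0.
  have lim0 : (fun h : R => h^-1 *: ((flat_exp m \o shift 0) (h *: 1) - flat_exp m 0)) @ 0^' --> (0 : R).
    apply/cvgrPdist_le => e e0; near=> h.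
    have h0 : h != 0 by near: h; exact: nbhs_dnbhs_neq.
    rewrite /= /shift addr0 (flat_exp_nonpos m (lexx 0)) subr0 sub0r normrN [h *: 1]mulr1.
    rewrite flat_exp_factor /GRing.scale /= mulKf// (le_trans (flat_exp_le _ _))//.
    rewrite mulrC -ler_pdivlMr ?ltr0n ?fact_gt0//.
    near: h; apply: dnbhs0_le; by rewrite divr_gt0 ?ltr0n ?fact_gt0.
  by split; [apply/cvg_ex; exists 0|exact/cvg_lim].
Unshelve. all: by end_near. Qed.
End flat_exp.

Section bump_fun.
Context {R : realType} {n : nat}.

Lemma Ck_flat_exp k m (O : set 'rV[R]_n) (f : 'rV[R]_n -> R) : open O -> Ck k O f ->
  Ck k O (fun x => flat_exp m (f x)).
Proof.
move=> oO; elim: k m => [|k IH] m Cf.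
  split=> // x Ox; apply: continuous_comp; first exact: Ck_continuous Cf Ox.
  apply: differentiable_continuous; apply/derivable1_diffP.
  by have [] := is_derive_flat_exp m (f x).
have df x : O x -> differentiable (f : _ -> R) x.
  by move=> Ox; exact: (Ck_differentiable oO Cf Ox).
have dh (x : R) : differentiable (flat_exp m) x.
  by apply/derivable1_diffP; have [] := is_derive_flat_exp m x.
have dhf x : O x -> differentiable (flat_exp m \o f : _ -> R) x.
  by move=> Ox; apply: differentiable_comp; [exact: df|exact: dh].
have Cf' := Ck_le Cf; split=> [x Ox|]; last split=> [x i Ox|i].
- exact: differentiable_continuous (dhf x Ox).
- exact: diff_derivable (dhf x Ox).
- apply: (Ck_eq_on (f := fun x => (flat_exp m.+2 (f x) + (- m%:R) * flat_exp m.+1 (f x)) * partial i f x)) => //.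
    move=> x Ox; rewrite [RHS]/partial deriveE; last exact: dhf.
    rewrite (diff_comp (df x Ox) (dh (f x))) /= diff1E//.
    rewrite derive1E (derive_val (is_derive := is_derive_flat_exp m (f x))).
    by rewrite /partial deriveE ?mulNr 1?mulrC//; exact: df.
  apply: Ck_mul => //; last by have [_ [_]] := Cf; apply.
  by apply: Ck_add => //; [exact: IH|apply: Ck_mul => //; [exact: Ck_cst|exact: IH]].
Qed.

(** The inner flat_exp is positive exactly on the open ball of squared radius r,
    and at least c on a smaller one; the outer flat_exp is positive exactly where
    the inner value is below c, and equals flat_exp 0 c where the inner value
    vanishes. The result is therefore 1 near x0 and 0 off the ball, with no
    quotient of varying functions to differentiate. *)
Definition bump_fun (x0 : 'rV[R]_n) (r : R) (x : 'rV[R]_n) : R :=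
  let c := flat_exp 0 (r / 2) in
  1 - flat_exp 0 (c - flat_exp 0 (r - \sum_i (x - x0) 0 i ^+ 2)) / flat_exp 0 c.

Lemma bump_fun_smooth x0 r O : open O -> smooth_on O (bump_fun x0 r).
Proof.
move=> oO; apply/smooth_onP => k; rewrite /bump_fun; set c := flat_exp 0 (r / 2).
have Cs a b : Ck k O b -> Ck k O (fun x => a - b x).
  move=> Cb; apply: (Ck_eq_on (f := fun x => a + (-1) * b x)) => //.
    by move=> x _; rewrite mulN1r.
  by apply: Ck_add => //; [exact: Ck_cst|apply: Ck_mul => //; exact: Ck_cst].
apply: (Cs); apply: (Ck_mul oO); last exact: Ck_cst.
apply: Ck_flat_exp => //; apply: (Cs); apply: Ck_flat_exp => //; apply: (Cs).
apply: Ck_sum => // i.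
have Ci : Ck k O (fun x : 'rV[R]_n => x 0 i + - x0 0 i).
  by apply: Ck_add => //; [exact: Ck_coord|exact: Ck_cst].
apply: Ck_eq_on (Ck_mul oO Ci Ci) => // x _.
by rewrite !mxE expr2.
Qed.

Lemma bump_fun_near x0 r : 0 < r -> \forall x \near x0, bump_fun x0 r x = 1.
Proof.
move=> r0; have c0 : 0 < flat_exp 0 (r / 2) by rewrite flat_exp_pos// divr_gt0.
have q0 : {for x0, continuous (fun x : 'rV[R]_n => \sum_i (x - x0) 0 i ^+ 2)}.
  apply: continuous_big_sum => i.
  rewrite (_ : (fun _ => _) = fun x : 'rV[R]_n => (x 0 i - x0 0 i) * (x 0 i - x0 0 i)).
    have ci : {for x0, continuous (fun x : 'rV[R]_n => x 0 i - x0 0 i)}.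
      apply: continuousB; last exact: cst_continuous.
      exact: coord_continuous.
    exact: continuousM.
  by apply/funext => x; rewrite !mxE expr2.
have r2 : 0 < r / 2 by rewrite divr_gt0.
have [d d0 H] := continuous_near_dist q0 r2.
apply/nbhs_ballP; exists d => //= x; rewrite -ball_normE /= distrC => /H.
rewrite subrr [\sum_i _]big1 => [|i _]; last by rewrite mxE expr0n.
rewrite sub0r normrN ger0_norm; last by apply: sumr_ge0 => i _; exact: sqr_ge0.
rewrite /bump_fun; set q := \sum_i _ => qr.
rewrite [flat_exp 0 (_ - flat_exp 0 (r - q))]flat_exp_nonpos ?mul0r ?subr0//.
rewrite subr_le0 /flat_exp !expr0 !mul1r r2.
have rq : 0 < r - q by lra.
rewrite rq ler_expR lerN2 lef_pV2 ?posrE//; lra.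
Qed.

Lemma bump_fun_support x0 r x : 0 < r -> bump_fun x0 r x != 0 -> \sum_i (x - x0) 0 i ^+ 2 < r.
Proof.
move=> r0; apply: contraNT; rewrite -leNgt => h.
have c0 : 0 < flat_exp 0 (r / 2) by rewrite flat_exp_pos// divr_gt0.
rewrite /bump_fun [flat_exp 0 (r - _)]flat_exp_nonpos ?subr_le0// subr0 divff ?subrr//.
by rewrite gt_eqF// flat_exp_pos.
Qed.

Lemma bump_fun_support_norm x0 r x : 0 < r -> bump_fun x0 (r ^+ 2) x != 0 -> `|x - x0| <= r.
Proof.
move=> r0 /bump_fun_support; rewrite exprn_gt0// => /(_ isT) h.
apply/row_norm_le => [|i]; first exact: ltW.
rewrite -(ler_pXn2r (n := 2))// ?nnegrE// ?ltW// real_normK ?num_real//.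
apply: le_lt_trans h; rewrite (bigD1 i)//= lerDl sumr_ge0// => j _.
exact: sqr_ge0.
Qed.

End bump_fun.

(** * Smooth matrix functions and jacobians *)

Section smooth_closure.
Context {R : realType} {n : nat}.
Implicit Types (f g : 'rV[R]_n -> R) (O : set 'rV[R]_n) (x : 'rV[R]_n).

Lemma smooth_eq_on O f g : open O -> (forall x, O x -> f x = g x) ->
  smooth_on O f -> smooth_on O g.
Proof.
by move=> oO fg /smooth_onP sf; apply/smooth_onP => k; exact: Ck_eq_on fg (sf k).
Qed.

Lemma smooth_sub O O' f : O' `<=` O -> smooth_on O f -> smooth_on O' f.
Proof. by move=> OO sf s x /OO; exact: sf. Qed.

Lemma smooth_cst O (a : R) : smooth_on O (cst a).
Proof. by apply/smooth_onP => k; exact: Ck_cst. Qed.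

Lemma smooth_mul O f g : open O -> smooth_on O f -> smooth_on O g ->
  smooth_on O (fun x => f x * g x).
Proof.
move=> oO /smooth_onP sf /smooth_onP sg; apply/smooth_onP => k.
exact: Ck_mul.
Qed.

Lemma smooth_sum O (I : Type) (s : seq I) (F : I -> 'rV[R]_n -> R) : open O ->
  (forall i, smooth_on O (F i)) -> smooth_on O (fun x => \sum_(i <- s) F i x).
Proof.
move=> oO sF; apply/smooth_onP => k; apply: Ck_sum => // i.
by move/smooth_onP: (sF i).
Qed.

Lemma smooth_prod O (I : Type) (s : seq I) (F : I -> 'rV[R]_n -> R) : open O ->
  (forall i, smooth_on O (F i)) -> smooth_on O (fun x => \prod_(i <- s) F i x).
Proof.
move=> oO sF; apply/smooth_onP => k; apply: Ck_prod => // i.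
by move/smooth_onP: (sF i).
Qed.

Lemma smooth_inv O f : open O -> (forall x, O x -> f x != 0) -> smooth_on O f ->
  smooth_on O (fun x => (f x)^-1).
Proof.
by move=> oO f0 /smooth_onP sf; apply/smooth_onP => k; exact: Ck_inv.
Qed.

Lemma smooth_comp m (O : set 'rV[R]_m) O' (F : 'rV[R]_m -> 'rV[R]_n) f :
  open O -> open O' -> (forall z, O z -> O' (F z)) -> smooth_mx_on O F ->
  smooth_on O' f -> smooth_on O (f \o F).
Proof.
move=> oO oO' FO sF /smooth_onP sf; apply/smooth_onP => k.
by apply: (Ck_comp oO oO' FO) (sf k) => j; move/smooth_onP: (sF 0 j).
Qed.

Lemma smooth_det k O (A : 'rV[R]_n -> 'M[R]_k) : open O -> smooth_mx_on O A ->
  smooth_on O (fun x => \det (A x)).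
Proof.
move=> oO sA; rewrite /determinant; apply: smooth_sum => // s.
apply: smooth_mul => //; first exact: smooth_cst.
by apply: smooth_prod => // i; exact: sA.
Qed.

Lemma smooth_mulmx k l m O (A : 'rV[R]_n -> 'M[R]_(k, l)) (B : 'rV[R]_n -> 'M[R]_(l, m)) :
  open O -> smooth_mx_on O A -> smooth_mx_on O B -> smooth_mx_on O (fun x => A x *m B x).
Proof.
move=> oO sA sB i j.
apply: (smooth_eq_on (f := fun x => \sum_a A x i a * B x a j)) => //.
  by move=> x _; rewrite mxE.
by apply: smooth_sum => // a; apply: smooth_mul.
Qed.

Lemma smooth_invmx k O (A : 'rV[R]_n -> 'M[R]_k) : open O ->
  (forall x, O x -> A x \in unitmx) -> smooth_mx_on O A ->
  smooth_mx_on O (fun x => invmx (A x)).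
Proof.
move=> oO Au sA i j.
apply: (smooth_eq_on (f := fun x => (\det (A x))^-1 * (\adj (A x)) i j)) => //.
  by move=> x Ox; rewrite /invmx Au// [RHS]mxE.
apply: smooth_mul => //.
  apply: smooth_inv => //; last exact: smooth_det.
  by move=> x /Au; rewrite unitmxE unitfE.
rewrite (_ : (fun _ => _) = fun x => (-1) ^+ (j + i) * \det (row' j (col' i (A x)))).
  apply: smooth_mul => //; first exact: smooth_cst.
  apply: smooth_det => // a b; rewrite (_ : (fun _ => _) = fun x => A x (lift j a) (lift i b)).
    exact: sA.
  by apply/funext => x; rewrite !mxE.
by apply/funext => x; rewrite mxE.
Qed.

End smooth_closure.

Section jacobian_lemmas.
Context {R : realType}.

Lemma jacobianE m n (f : 'rV[R]_m -> 'rV[R]_n) x i j : differentiable f x ->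
  ('J f x) i j = partial i (fun y => f y 0 j) x.
Proof.
move=> df; rewrite mxE diff_row// /partial deriveE//.
exact: (differentiable_comp df (differentiable_coord _ _ _)).
Qed.

Lemma mul_jacobian m n (f : 'rV[R]_m -> 'rV[R]_n) x v :
  v *m 'J f x = 'd f x v.
Proof. by rewrite /jacobian mul_rV_lin1. Qed.

Lemma jacobian_comp m n l (f : 'rV[R]_m -> 'rV[R]_n) (h : 'rV[R]_n -> 'rV[R]_l) x :
  differentiable f x -> differentiable h (f x) ->
  'J (h \o f) x = 'J f x *m 'J h (f x).
Proof.
move=> df dh; apply/row_matrixP => i; rewrite row_mul rowE mul_jacobian.
by rewrite diff_comp//= mul_jacobian rowE mul_jacobian.
Qed.

Lemma jacobian_near_id m (f : 'rV[R]_m -> 'rV[R]_m) x : differentiable f x ->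
  (\forall y \near x, f y = y) -> 'J f x = 1%:M.
Proof.
move=> df fid; apply/row_matrixP => i; rewrite rowE mul_jacobian -deriveE//.
rewrite (near_eq_derive (g := id))// derive_id row1//.
Qed.

Lemma jacobian_near_eq m n (f h : 'rV[R]_m -> 'rV[R]_n) x : differentiable f x ->
  differentiable h x -> (\forall y \near x, f y = h y) -> 'J f x = 'J h x.
Proof.
move=> df dh fh; have E v : 'd f x v = 'd h x v.
  apply: etrans (esym (deriveE v df)) _; apply: etrans (deriveE v dh).
  exact: near_eq_derive fh.
apply/row_matrixP => i; apply: etrans (rowE i _) _; apply: etrans (esym (rowE i _)).
exact: (etrans (mul_jacobian f x _) (etrans (E _) (esym (mul_jacobian h x _)))).
Qed.

End jacobian_lemmas.

(** * Transition maps and components of tensors *)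

Section charts.
Context {R : realType} {n : nat} {M : manifold R n}.
Implicit Types (c : chart R n M) (p q : M) (x y : 'rV[R]_n).

Definition overlap c c' := cimg c `&` cinv c @^-1` cdom c'.

Lemma chart_preimage_open c (U : set M) : open U -> open (cimg c `&` cinv c @^-1` U).
Proof.
move=> oU; rewrite openE => x [xc Ux]; apply: filterI.
  exact: open_nbhs_nbhs (conj (@cimg_open _ _ _ c) xc).
exact: (cinv_continuous xc) (open_nbhs_nbhs (conj oU Ux)).
Qed.

Lemma overlap_open c c' : open (overlap c c').
Proof. exact/chart_preimage_open/cdom_open. Qed.

Lemma overlap_cmap c c' p : cdom c p -> cdom c' p -> overlap c c' (cmap c p).
Proof. by move=> cp c'p; split; [exact: cmap_img|rewrite /= cmapK]. Qed.

Lemma transition_differentiable c c' x : atlas c -> atlas c' ->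
  overlap c c' x -> differentiable (cmap c' \o cinv c) x.
Proof.
move=> ac ac' Ox; apply: differentiable_row => j.
exact: smooth_differentiable (@overlap_open c c')  (atlas_smooth ac ac' 0 j) Ox.
Qed.

Lemma transition_jacobian_cocycle c c' c'' p : atlas c -> atlas c' -> atlas c'' ->
  cdom c p -> cdom c' p -> cdom c'' p ->
  transition_jacobian c c' p *m transition_jacobian c' c'' p = transition_jacobian c c'' p.
Proof.
move=> a a' a'' cp cp' cp''; rewrite /transition_jacobian.
have E : (cmap c' \o cinv c) (cmap c p) = cmap c' p by rewrite /= cmapK.
have d1 := transition_differentiable a a' (overlap_cmap cp cp').
have d2 : differentiable (cmap c'' \o cinv c') ((cmap c' \o cinv c) (cmap c p)).
  by rewrite E; exact: transition_differentiable a' a'' (overlap_cmap cp' cp'').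
have d3 := transition_differentiable a a'' (overlap_cmap cp cp'').
have JE := jacobian_comp d1 d2; rewrite E in JE.
apply: etrans (esym JE) _.
apply: jacobian_near_eq (differentiable_comp d1 d2) d3 _.
apply: near_open (@overlap_open c c') (overlap_cmap cp cp') _ => y [yc yc'].
by rewrite /= cmapK.
Qed.

Lemma transition_jacobian_id c p : atlas c -> cdom c p -> transition_jacobian c c p = 1%:M.
Proof.
move=> a cp; apply: jacobian_near_id.
  exact: transition_differentiable (overlap_cmap cp cp).
apply: near_open (@cimg_open _ _ _ c) (cmap_img cp) _ => y yc.
exact: cinvK.
Qed.

Lemma transition_jacobianK c c' p : atlas c -> atlas c' -> cdom c p -> cdom c' p ->
  transition_jacobian c c' p *m transition_jacobian c' c p = 1%:M.
Proof.
by move=> a a' cp cp'; rewrite transition_jacobian_cocycle// transition_jacobian_id.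
Qed.

End charts.

(** Covectors transform by A^T and vectors by its inverse B, so contractions do not
    depend on the basis. *)
Section change_of_basis.
Context {R : fieldType} {n : nat} (A B : 'M[R]_n).
Hypothesis AB : A *m B = 1%:M.

Let BA : B *m A = 1%:M. Proof. exact: mulmx1C. Qed.

Lemma mulmx_contragredient m (a : 'rV[R]_n) (S : 'M[R]_(n, m)) :
  a *m A^T *m (B^T *m S) = a *m S.
Proof. by rewrite mulmxA -(mulmxA a) -trmx_mul BA trmx1 mulmx1. Qed.

Lemma pairing_contragredient (a b : 'rV[R]_n) (S : 'M[R]_n) :
  a *m A^T *m (B^T *m S *m B) *m (b *m A^T)^T = a *m S *m b^T.
Proof.
rewrite -[B^T *m _ *m _]mulmxA mulmx_contragredient trmx_mul trmxK !mulmxA.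
by rewrite -[_ *m B *m A]mulmxA BA mulmx1.
Qed.

Lemma anchor_contragredient (a : 'rV[R]_n) (S : 'M[R]_n) :
  a *m S *m B = a *m A^T *m (B^T *m S *m B).
Proof. by rewrite -[B^T *m _ *m _]mulmxA mulmx_contragredient mulmxA. Qed.

Lemma congr_unitmx (S : 'M[R]_n) : S \in unitmx -> A *m S *m A^T \in unitmx.
Proof.
by move=> Su; have [Au _] := mulmx1_unit AB; rewrite !unitmx_mul unitmx_tr Au Su.
Qed.

Lemma invmx_congr (S : 'M[R]_n) : S \in unitmx ->
  invmx (A *m S *m A^T) = B^T *m invmx S *m B.
Proof.
move=> Su; have mu := congr_unitmx Su.
have E : A *m S *m A^T *m (B^T *m invmx S *m B) = 1%:M.
  rewrite !mulmxA -[_ *m A^T *m B^T]mulmxA -trmx_mul BA trmx1 mulmx1.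
  by rewrite -(mulmxA A) mulmxV// mulmx1 AB.
move: mu E; move: (A *m S *m A^T) => m mu E.
by rewrite -[RHS]mul1mx -(mulVmx mu) -(mulmxA (invmx m)) E mulmx1.
Qed.

End change_of_basis.

Section components.
Context {R : realType} {n : nat} {M : manifold R n}.
Variables (c : chart R n M) (y : 'rV[R]_n).
Hypotheses (ac : atlas c) (yc : cimg c y).
Implicit Types (g : metric_field M) (P : bivector_field M) (al be : covector_field M).

Local Notation p := (cinv c y).

Let cp : cdom c p. Proof. exact: cinv_dom. Qed.
Let J12 : transition_jacobian c (chart_at p) p *m transition_jacobian (chart_at p) c p = 1%:M.
Proof. by apply: transition_jacobianK => //; [exact: chart_at_atlas|exact: chart_at_dom]. Qed.

Lemma bivector_pairing_comp P al be :
  bivector_pairing P al be p = (fcomp c al y *m bcomp c P y *m (fcomp c be y)^T) 0 0.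
Proof.
exact: (congr1 (fun S : 'M[R]_1 => S 0 0) (esym (pairing_contragredient J12 (al p) (be p) (P p)))).
Qed.

Lemma vcomp_anchor P al : vcomp c (anchor P al) y = fcomp c al y *m bcomp c P y.
Proof.
exact: (anchor_contragredient J12 (al p) (P p)).
Qed.

Lemma mcomp_unit g : g p \in unitmx -> mcomp c g y \in unitmx.
Proof. exact: congr_unitmx J12 _. Qed.

Lemma invmx_mcomp g : g p \in unitmx ->
  invmx (mcomp c g y) = (transition_jacobian (chart_at p) c p)^T *m invmx (g p)
    *m transition_jacobian (chart_at p) c p.
Proof. exact: invmx_congr J12 _. Qed.

Lemma cometric_comp g al be : g p \in unitmx ->
  cometric g al be p = (fcomp c al y *m invmx (mcomp c g y) *m (fcomp c be y)^T) 0 0.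
Proof.
move=> gu; rewrite (invmx_mcomp gu).
exact: (congr1 (fun S : 'M[R]_1 => S 0 0)
  (esym (pairing_contragredient J12 (al p) (be p) (invmx (g p))))).
Qed.

Lemma vcomp_gradient g f : g p \in unitmx ->
  vcomp c (gradient g f) y = fcomp c (differential f) y *m invmx (mcomp c g y).
Proof.
move=> gu; rewrite (invmx_mcomp gu).
exact: (anchor_contragredient J12 (differential f p) (invmx (g p))).
Qed.

Lemma deriv_comp (X : vector_field M) (f : M -> R) :
  differentiable (f \o cinv c : _ -> R^o) y ->
  Defs.deriv X f p = 'd (f \o cinv c : _ -> R^o) y (vcomp c X y).
Proof.
move=> df; pose cq := chart_at p.
have aq : atlas cq by exact: chart_at_atlas.
have qp : cdom cq p by exact: chart_at_dom.
have E : (cmap c \o cinv cq) (cmap cq p) = y by rewrite /= cmapK// cinvK.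
have dt := transition_differentiable aq ac (overlap_cmap qp cp).
have dfE : differentiable (f \o cinv c : _ -> R^o) ((cmap c \o cinv cq) (cmap cq p)).
  by rewrite E.
have DC := diff_comp dt dfE; rewrite E in DC.
transitivity ('D_(X p) ((f \o cinv c : _ -> R^o) \o (cmap c \o cinv cq)) (cmap cq p)).
  apply: near_eq_derive.
  apply: near_open (@overlap_open _ _ _ cq c) (overlap_cmap qp cp) _ => z [zq zc] /=.
  by rewrite cmapK.
apply: etrans (deriveE _ (differentiable_comp dt dfE)) _.
apply: etrans (congr1 (fun k => k (X p)) DC) _.
exact: (congr1 ('d (f \o cinv c : _ -> R^o) y) (esym (mul_jacobian _ _ (X p)))).
Qed.

Lemma fcomp_differential (U : set M) (f : M -> R) : open U -> U p -> smooth_function U f ->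
  fcomp c (differential f) y = \row_i partial i (f \o cinv c) y.
Proof.
move=> oU Up sf; pose cq := chart_at p.
have aq : atlas cq by exact: chart_at_atlas.
have qp : cdom cq p by exact: chart_at_dom.
have yE : cmap c p = y by rewrite cinvK.
have E : (cmap cq \o cinv c) y = cmap cq p by [].
have := overlap_cmap cp qp; rewrite yE => Oy.
have dt := transition_differentiable ac aq Oy.
have dfq : differentiable (f \o cinv cq : _ -> R^o) (cmap cq p).
  apply: smooth_differentiable (@chart_preimage_open _ _ _ cq U oU) (sf _ aq) _.
  by split; [exact: cmap_img|rewrite /= cmapK].
apply/rowP => i; rewrite [RHS]mxE.
transitivity (partial i ((f \o cinv cq) \o (cmap cq \o cinv c)) y).
  rewrite partial_comp ?E//.
  rewrite /fcomp -/cq mxE; apply: eq_bigr => j _.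
  rewrite [_^T _ _]mxE /transition_jacobian yE jacobianE//.
  by rewrite /differential -/cq mxE.
apply: partial_eq_near; apply: near_open (@overlap_open _ _ _ c cq) Oy _ => z [zc zq] /=.
by rewrite cmapK.
Qed.

End components.

(** * One-forms with constant components near a point *)

Section extension.
Context {R : realType} {n : nat} {M : manifold R n}.
Variables (c : chart R n M) (x0 : 'rV[R]_n) (r : R).
Hypotheses (ac : atlas c) (r0 : 0 < r) (rc : forall x, `|x - x0| <= r -> cimg c x).

(** The form with constant components v in the chart c, times a bump function,
    extended by 0 off the domain of c. *)
Definition cutoff_form (v : 'rV[R]_n) : covector_field M := fun q =>
  if `[< cdom c q >] then
    bump_fun x0 (r ^+ 2) (cmap c q) *: (v *m (transition_jacobian (chart_at q) c q)^T)
  else 0.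

Let supp : set M := cinv c @` [set x | `|x - x0| <= r].

Let supp_closed : closed supp.
Proof.
apply: compact_closed; first exact: manifold_hausdorff.
apply: continuous_compact.
  apply: continuous_in_subspaceT => x; rewrite inE => /rc xc.
  exact: cinv_continuous.
have -> : [set x | `|x - x0| <= r] = closed_ball x0 r.
  rewrite closed_ballE//; apply/seteqP; split=> x; rewrite /closed_ball_ /= distrC//.
apply: bounded_closed_compact; last exact: closed_ball_closed.
rewrite closed_ballE//; exists (`|x0| + r); split; first exact: num_real.
move=> s sr x; rewrite /closed_ball_ /= => xr.
rewrite -[x](subrK x0) addrC (le_trans (ler_normD _ _))//.
by rewrite (le_trans _ (ltW sr))// lerD2l distrC.
Qed.

Lemma cutoff_form_off v q : ~ supp q -> cutoff_form v q = 0.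
Proof.
move=> sq; rewrite /cutoff_form; case: asboolP => // cq.
suff -> : bump_fun x0 (r ^+ 2) (cmap c q) = 0 by rewrite scale0r.
apply/eqP; apply: contra_notT sq => /(bump_fun_support_norm r0) h.
by exists (cmap c q) => //; exact: cmapK.
Qed.

Lemma cutoff_form_fcomp v c' y : atlas c' -> overlap c' c y ->
  fcomp c' (cutoff_form v) y =
  bump_fun x0 (r ^+ 2) (cmap c (cinv c' y)) *: (v *m (transition_jacobian c' c (cinv c' y))^T).
Proof.
move=> ac' [yc' yc]; set q := cinv c' y.
have J := transition_jacobian_cocycle ac' (chart_at_atlas q) ac (cinv_dom yc') (chart_at_dom q) yc.
have -> : fcomp c' (cutoff_form v) y = cutoff_form v q *m (transition_jacobian c' (chart_at q) q)^T by [].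
rewrite /cutoff_form; case: asboolP => // _.
by rewrite -J trmx_mul -scalemxAl mulmxA.
Qed.

Lemma cutoff_form_near v : \forall y \near x0, fcomp c (cutoff_form v) y = v.
Proof.
have x0c : cimg c x0 by apply: rc; rewrite subrr normr0 ltW.
have b1 := @bump_fun_near R n x0 (r ^+ 2) (exprn_gt0 _ r0).
have yc := open_nbhs_nbhs (conj (@cimg_open _ _ _ c) x0c).
apply: filterS2 b1 yc => y by1 yc.
have Oy : overlap c c y by split=> //; exact: cinv_dom.
rewrite (cutoff_form_fcomp _ ac Oy) cinvK// by1 scale1r.
by rewrite (transition_jacobian_id ac (cinv_dom yc)) trmx1 mulmx1.
Qed.

(** A chart c' is covered by its overlap with c and by the complement of the
    support, which is open because the support is compact in a Hausdorff space. *)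
Lemma cutoff_form_smooth v : smooth_one_form (cutoff_form v).
Proof.
move=> c' ac' i j; rewrite (ord1 i).
have -> : cimg c' = overlap c' c `|` (cimg c' `&` cinv c' @^-1` (~` supp)).
  apply/seteqP; split=> [y yc'|y [[]|[]]//].
  have [sy|sy] := pselect (supp (cinv c' y)); last by right.
  by left; split=> //=; case: sy => x /rc xc <-; exact: cinv_dom.
have s1 : smooth_on (overlap c' c) (fun y => fcomp c' (cutoff_form v) y 0 j).
  have oO := @overlap_open _ _ _ c' c.
  pose t := cmap c \o cinv c'.
  have st : smooth_mx_on (overlap c' c) t by exact: atlas_smooth.
  apply: (smooth_eq_on (f := fun y => bump_fun x0 (r ^+ 2) (t y) *
     \sum_k v 0 k * partial j (fun z => t z 0 k) y)) => //.
    move=> y Oy; rewrite (cutoff_form_fcomp _ ac' Oy) mxE; congr (_ * _).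
    rewrite mxE; apply: eq_bigr => k _; congr (_ * _); rewrite mxE.
    case: (Oy) => yc' yc; rewrite /transition_jacobian (cinvK yc').
    by rewrite (jacobianE _ _ (transition_differentiable ac' ac Oy)).
  apply: smooth_mul => //.
    apply: (smooth_comp oO (@openT _) (fun _ _ => I) st).
    by apply: bump_fun_smooth; exact: openT.
  apply: smooth_sum => // k; apply: smooth_mul => //; first exact: smooth_cst.
  exact: smooth_partial.
have s2 : smooth_on (cimg c' `&` cinv c' @^-1` (~` supp)) (fun y => fcomp c' (cutoff_form v) y 0 j).
  apply: (smooth_eq_on (f := cst 0)); last exact: smooth_cst.
    by apply: (@chart_preimage_open _ _ _ c'); exact: closed_openC.
  by move=> y [_ /= sy]; rewrite /fcomp cutoff_form_off// mul0mx mxE.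
by move=> s y [/(s1 s)|/(s2 s)].
Qed.

End extension.

(** * Partial derivatives of matrix functions *)

Section matrix_partials.
Context {R : realType} {n : nat}.
Implicit Types (x y : 'rV[R]_n) (O : set 'rV[R]_n).

Lemma partialM (f g : 'rV[R]_n -> R) x i :
  differentiable (f : _ -> R^o) x -> differentiable (g : _ -> R^o) x ->
  partial i (fun y => f y * g y) x = f x * partial i g x + g x * partial i f x.
Proof.
move=> df dg.
exact: (deriveM (diff_derivable (v := delta_mx 0 i) df) (diff_derivable (v := delta_mx 0 i) dg)).
Qed.

Lemma partialD (f g : 'rV[R]_n -> R) x i :
  differentiable (f : _ -> R^o) x -> differentiable (g : _ -> R^o) x ->
  partial i (fun y => f y + g y) x = partial i f x + partial i g x.
Proof.
move=> df dg.
exact: (deriveD (diff_derivable (v := delta_mx 0 i) df) (diff_derivable (v := delta_mx 0 i) dg)).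
Qed.

Lemma partial_cst (a : R) x i : partial i (cst a : 'rV[R]_n -> R) x = 0.
Proof. exact: derive_cst. Qed.

Lemma differentiable_bigsum (I : Type) (s : seq I) (F : I -> 'rV[R]_n -> R) x :
  (forall j, differentiable (F j : _ -> R^o) x) ->
  differentiable ((fun y => \sum_(j <- s) F j y) : _ -> R^o) x.
Proof.
move=> dF; elim: s => [|j s IH].
  rewrite (_ : (fun y => _) = cst 0); first exact: differentiable_cst.
  by apply/funext => y; rewrite big_nil.
rewrite (_ : (fun y => _) = (F j : _ -> R^o) + (fun y => \sum_(k <- s) F k y : R^o)).
  exact: differentiableD.
by apply/funext => y; rewrite big_cons.
Qed.

Lemma partial_sum (I : Type) (s : seq I) (F : I -> 'rV[R]_n -> R) x i :
  (forall j, differentiable (F j : _ -> R^o) x) ->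
  partial i (fun y => \sum_(j <- s) F j y) x = \sum_(j <- s) partial i (F j) x.
Proof.
move=> dF; elim: s => [|j s IH].
  rewrite big_nil (_ : (fun y => _) = cst 0) ?partial_cst//.
  by apply/funext => y; rewrite big_nil.
rewrite big_cons -IH -partialD//; last exact: differentiable_bigsum.
by congr (partial i _ x); apply/funext => y; rewrite big_cons.
Qed.

Definition mx_partial k l (i : 'I_n) (A : 'rV[R]_n -> 'M[R]_(k, l)) x : 'M[R]_(k, l) :=
  \matrix_(a, b) partial i (fun y => A y a b) x.

Definition entries_differentiable k l (A : 'rV[R]_n -> 'M[R]_(k, l)) x :=
  forall a b, differentiable ((fun y => A y a b) : _ -> R^o) x.

Lemma smooth_entries_differentiable O k l (A : 'rV[R]_n -> 'M[R]_(k, l)) x : open O ->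
  smooth_mx_on O A -> O x -> entries_differentiable A x.
Proof. by move=> oO sA Ox a b; exact: smooth_differentiable oO (sA a b) Ox. Qed.

Lemma mx_partial_eq_on O k l i (A B : 'rV[R]_n -> 'M[R]_(k, l)) x : open O -> O x ->
  (forall y, O y -> A y = B y) -> mx_partial i A x = mx_partial i B x.
Proof.
move=> oO Ox AB; apply/matrixP => a b; rewrite [LHS]mxE [RHS]mxE.
by apply: (partial_eq_on i oO Ox) => y Oy; rewrite AB.
Qed.

Lemma mx_partial_cst k l i (A : 'M[R]_(k, l)) x : mx_partial i (cst A) x = 0.
Proof. by apply/matrixP => a b; rewrite [LHS]mxE [RHS]mxE; exact: partial_cst. Qed.

Lemma mx_partial_tr k l i (A : 'rV[R]_n -> 'M[R]_(k, l)) x :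
  mx_partial i (fun y => (A y)^T) x = (mx_partial i A x)^T.
Proof.
apply/matrixP => a b; rewrite [LHS]mxE 2![RHS]mxE.
by congr (partial i _ x); apply/funext => y; rewrite mxE.
Qed.

Lemma entries_differentiable_tr k l (A : 'rV[R]_n -> 'M[R]_(k, l)) x :
  entries_differentiable A x -> entries_differentiable (fun y => (A y)^T) x.
Proof.
move=> dA a b; rewrite (_ : (fun y => _) = fun y => A y b a); first exact: dA.
by apply/funext => y; rewrite mxE.
Qed.

Lemma entries_differentiable_mul k l m (A : 'rV[R]_n -> 'M[R]_(k, l))
    (B : 'rV[R]_n -> 'M[R]_(l, m)) x :
  entries_differentiable A x -> entries_differentiable B x ->
  entries_differentiable (fun y => A y *m B y) x.
Proof.
move=> dA dB a b.
rewrite (_ : (fun y => _) = fun y => \sum_j A y a j * B y j b).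
  apply: differentiable_bigsum => j.
  exact: (differentiableM (dA a j) (dB j b)).
by apply/funext => y; rewrite mxE.
Qed.

Lemma mx_partialD k l i (A B : 'rV[R]_n -> 'M[R]_(k, l)) x :
  entries_differentiable A x -> entries_differentiable B x ->
  mx_partial i (fun y => A y + B y) x = mx_partial i A x + mx_partial i B x.
Proof.
move=> dA dB; apply/matrixP => a b; rewrite [LHS]mxE [RHS]mxE [X in X + _]mxE [X in _ + X]mxE.
rewrite -partialD//.
by congr (partial i _ x); apply/funext => y; rewrite mxE.
Qed.

Lemma mx_partialM k l m i (A : 'rV[R]_n -> 'M[R]_(k, l))
    (B : 'rV[R]_n -> 'M[R]_(l, m)) x :
  entries_differentiable A x -> entries_differentiable B x ->
  mx_partial i (fun y => A y *m B y) x =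
  mx_partial i A x *m B x + A x *m mx_partial i B x.
Proof.
move=> dA dB; apply/matrixP => a b; rewrite [LHS]mxE [RHS]mxE.
rewrite [X in X + _]mxE [X in _ + X]mxE -big_split.
transitivity (partial i (fun y => \sum_j A y a j * B y j b) x).
  by congr (partial i _ x); apply/funext => y; rewrite mxE.
rewrite partial_sum => [|j]; last exact: (differentiableM (dA a j) (dB j b)).
apply: eq_bigr => j _; rewrite (partialM _ (dA a j) (dB j b)) [mx_partial i A x a j]mxE [mx_partial i B x j b]mxE.
by rewrite addrC [B x j b * _]mulrC.
Qed.

Lemma mx_partial_sumZ k l i (F : 'I_n -> 'rV[R]_n -> R) (A : 'I_n -> 'rV[R]_n -> 'M[R]_(k, l)) x :
  (forall j, differentiable (F j : _ -> R^o) x) -> (forall j, entries_differentiable (A j) x) ->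
  mx_partial i (fun y => \sum_j F j y *: A j y) x =
  \sum_j (partial i (F j) x *: A j x + F j x *: mx_partial i (A j) x).
Proof.
move=> dF dA; apply/matrixP => a b; rewrite [LHS]mxE summxE.
transitivity (partial i (fun y => \sum_j F j y * A j y a b) x).
  congr (partial i _ x); apply/funext => y; rewrite summxE.
  by apply: eq_bigr => j _; rewrite mxE.
rewrite partial_sum => [|j]; last exact: (differentiableM (dF j) (dA j a b)).
apply: eq_bigr => j _; rewrite (partialM _ (dF j) (dA j a b)) [RHS]mxE addrC; congr (_ + _).
  by rewrite [RHS]mxE; congr (_ * _); rewrite mxE.
by rewrite [RHS]mxE mulrC.
Qed.

Lemma derive_mx_partial k l (A : 'rV[R]_n -> 'M[R]_(k, l)) x v :
  entries_differentiable A x -> 'D_v A x = \sum_i v 0 i *: mx_partial i A x.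
Proof.
move=> dA; rewrite derive_mx.
  apply/matrixP => a b; rewrite mxE summxE.
  apply: etrans (deriveE v (dA a b)) _; apply: etrans (diff_partial v (dA a b)) _.
  by apply: eq_bigr => i _; rewrite [RHS]mxE [X in _ = _ * X]mxE.
by apply/derivable_mxP => a b; exact: diff_derivable.
Qed.

Lemma jacobian_mx_partial m (F : 'rV[R]_n -> 'rV[R]_m) x :
  entries_differentiable F x -> 'J F x = \matrix_i (mx_partial i F x).
Proof.
move=> dF; have dF' : differentiable F x by apply: differentiable_row => j; exact: dF.
by apply/matrixP => i j; rewrite jacobianE// [RHS]mxE [RHS]mxE.
Qed.

End matrix_partials.

(** * The hypotheses in a coordinate frame *)

Section local_identities.
Context {R : realType} {n : nat} {M : manifold R n}.
Variables (g : metric_field M) (P : bivector_field M).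
Variables (D : covector_field M -> covector_field M -> covector_field M).
Variables (c : chart R n M) (O : set 'rV[R]_n) (e : 'I_n -> covector_field M).
Hypothesis gm : riemannian_metric g.
Hypothesis Ps : smooth_bivector_field P.
Hypothesis Dc : metric_contravariant_connection P g D.
Hypothesis DP : parallel_bivector P D.
Hypotheses (ac : atlas c) (oO : open O) (Oc : O `<=` cimg c).
Hypothesis es : forall i, smooth_one_form (e i).
Hypothesis eO : forall i y, O y -> fcomp c (e i) y = delta_mx 0 i.
Implicit Types (x y : 'rV[R]_n).

Lemma metric_unitmx p : g p \in unitmx.
Proof.
case: gm => _ _ gpos; rewrite -row_free_unit -kermx_eq0.
apply/eqP/row_matrixP => i; rewrite row0; apply/eqP; apply: contraT => /(gpos p).
by rewrite -row_mul mulmx_ker row0 mul0mx mxE ltxx.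
Qed.

Local Notation w := (bcomp c P).
Local Notation m := (mcomp c g).
Local Notation G := (fun y => invmx (m y)).
(** Row b consists of the components of D_{e_a} e_b. *)
Definition symbols a y : 'M[R]_n := \matrix_b fcomp c (D (e a) (e b)) y.

Lemma w_smooth : smooth_mx_on O w.
Proof. by move=> i j; apply: smooth_sub Oc _; exact: Ps.1. Qed.

Lemma m_smooth : smooth_mx_on O m.
Proof. by case: gm => gs _ _ i j; apply: smooth_sub Oc _; exact: gs. Qed.

Lemma m_unit y : O y -> m y \in unitmx.
Proof. by move=> Oy; apply: mcomp_unit (metric_unitmx _) => //; exact: Oc. Qed.

Lemma G_smooth : smooth_mx_on O G.
Proof. by apply: smooth_invmx m_smooth => //; exact: m_unit. Qed.

Lemma symbols_smooth a : smooth_mx_on O (symbols a).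
Proof.
move=> b k; rewrite (_ : (fun y => _) = fun y => fcomp c (D (e a) (e b)) y 0 k).
  apply: smooth_sub Oc _.
  exact: (mcc_smooth Dc (es a) (es b) ac 0 k).
by apply/funext => y; rewrite mxE.
Qed.

Lemma frame_pairing a b y : O y -> bivector_pairing P (e a) (e b) (cinv c y) = w y a b.
Proof.
move=> Oy; rewrite (bivector_pairing_comp ac (Oc Oy)) !eO//.
exact: form_delta.
Qed.

Lemma frame_cometric a b y : O y -> cometric g (e a) (e b) (cinv c y) = G y a b.
Proof.
move=> Oy; rewrite (cometric_comp ac (Oc Oy) _ _ (metric_unitmx _)) !eO//.
exact: form_delta.
Qed.

Lemma frame_anchor a y : O y -> vcomp c (anchor P (e a)) y = row a (w y).
Proof. by move=> Oy; rewrite (vcomp_anchor ac (Oc Oy)) eO// -rowE. Qed.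

(** The anchor of e_a is row a of the bivector, and derivations do not depend on
    the chart in which they are computed. *)
Lemma frame_deriv a (f : M -> R) (h : 'rV[R]_n -> R) y : O y -> smooth_on O h ->
  (forall z, O z -> f (cinv c z) = h z) ->
  Defs.deriv (anchor P (e a)) f (cinv c y) = \sum_l w y a l * partial l h y.
Proof.
move=> Oy sh fh.
have sf : smooth_on O (f \o cinv c) by apply: smooth_eq_on sh => // z /fh.
have df := smooth_differentiable oO sf Oy.
apply: etrans (deriv_comp ac (Oc Oy) _ df) _; apply: etrans (diff_partial _ df) _.
apply: eq_bigr => l _; rewrite frame_anchor// mxE; congr (_ * _).
exact: (partial_eq_on l oO Oy fh).
Qed.

Lemma form_symbols a b d y (S : 'M[R]_n) :
  (fcomp c (D (e a) (e b)) y *m S *m (delta_mx 0 d : 'rV[R]_n)^T) 0 0 = (symbols a y *m S) b d.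
Proof.
rewrite [LHS](form_delta_r S) [LHS]mxE [RHS]mxE; apply: eq_bigr => j _.
by rewrite [symbols a y b j]mxE.
Qed.

Lemma form_symbols_r a b d y (S : 'M[R]_n) :
  ((delta_mx 0 b : 'rV[R]_n) *m S *m (fcomp c (D (e a) (e d)) y)^T) 0 0 = (S *m (symbols a y)^T) b d.
Proof.
rewrite -rowE [LHS]mxE [RHS]mxE; apply: eq_bigr => j _.
by rewrite [row b S 0 j]mxE [(symbols a y)^T j d]mxE [symbols a y d j]mxE [_^T j 0]mxE.
Qed.

Lemma local_parallel a y : O y ->
  \sum_l w y a l *: mx_partial l w y = symbols a y *m w y + w y *m (symbols a y)^T.
Proof.
move=> Oy; apply/matrixP => b d; rewrite summxE [RHS]mxE.
have sw : smooth_on O (fun z => w z b d) by exact: w_smooth.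
have := DP (es a) (es b) (es d) (cinv c y).
rewrite (frame_deriv a Oy sw (@frame_pairing b d)).
rewrite !(bivector_pairing_comp ac (Oc Oy)) !eO// form_symbols form_symbols_r => <-.
by apply: eq_bigr => l _; rewrite [LHS]mxE [X in _ * X = _]mxE.
Qed.

Lemma local_metric a y : O y ->
  \sum_l w y a l *: mx_partial l G y = symbols a y *m G y + G y *m (symbols a y)^T.
Proof.
move=> Oy; apply/matrixP => b d; rewrite summxE [RHS]mxE.
have sw : smooth_on O (fun z => G z b d) by exact: G_smooth.
have := mcc_metric Dc (es a) (es b) (es d) (cinv c y).
rewrite (frame_deriv a Oy sw (@frame_cometric b d)).
rewrite !(cometric_comp ac (Oc Oy) _ _ (metric_unitmx _)) !eO// form_symbols form_symbols_r => <-.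
by apply: eq_bigr => l _; rewrite [LHS]mxE [X in _ * X = _]mxE.
Qed.

Lemma local_parallel_deriv i a x : O x ->
  \sum_l (mx_partial i w x a l *: mx_partial l w x
          + w x a l *: mx_partial i (mx_partial l w) x) =
  mx_partial i (symbols a) x *m w x + symbols a x *m mx_partial i w x
  + (mx_partial i w x *m (symbols a x)^T + w x *m (mx_partial i (symbols a) x)^T).
Proof.
move=> Ox.
have dw := smooth_entries_differentiable oO w_smooth Ox.
have dS := smooth_entries_differentiable oO (symbols_smooth a) Ox.
have ddw l : entries_differentiable (mx_partial l w) x.
  apply: (smooth_entries_differentiable oO _ Ox) => b d.
  rewrite (_ : (fun y => _) = partial l (fun y => w y b d)).
    exact/smooth_partial/w_smooth.
  by apply/funext => y; rewrite mxE.
rewrite -mx_partial_tr -!mx_partialM//; last exact: entries_differentiable_tr.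
rewrite -mx_partialD; last 2 first.
- exact: entries_differentiable_mul.
- by apply: entries_differentiable_mul => //; exact: entries_differentiable_tr.
rewrite -(mx_partial_eq_on i oO Ox (local_parallel a)).
rewrite mx_partial_sumZ//.
by apply: eq_bigr => l _; rewrite [mx_partial i w x a l]mxE.
Qed.

Lemma local_cometric_partial l x : O x ->
  mx_partial l G x = - (G x *m mx_partial l m x *m G x).
Proof.
move=> Ox.
have dm := smooth_entries_differentiable oO m_smooth Ox.
have dG := smooth_entries_differentiable oO G_smooth Ox.
have E y : O y -> m y *m G y = cst 1%:M y by move=> Oy; rewrite mulmxV// m_unit.
have := mx_partial_eq_on l oO Ox E; rewrite mx_partial_cst mx_partialM// => H.
have {}H : m x *m mx_partial l G x = - (mx_partial l m x *m G x).
  by apply/eqP; rewrite -addr_eq0 addrC H.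
by rewrite -mulmxA -mulmxN -H mulmxA mulVmx ?mul1mx// m_unit.
Qed.

End local_identities.

(** * The theorem *)

Lemma local_frame (R : realType) (n : nat) (M : manifold R n) (c : chart R n M)
    (x : 'rV[R]_n) : atlas c -> cimg c x ->
  exists (O : set 'rV[R]_n) (e : 'I_n -> covector_field M),
    [/\ open O, O x, O `<=` cimg c, forall i, smooth_one_form (e i) &
        forall i y, O y -> fcomp c (e i) y = delta_mx 0 i].
Proof.
move=> ac xc; have [r r0 rc] := open_near_dist (@cimg_open _ _ _ c) xc.
have r20 : 0 < r / 2 by rewrite divr_gt0.
have rc' y : `|y - x| <= r / 2 -> cimg c y.
  by move=> yx; apply: rc; rewrite (le_lt_trans yx)// ltr_pdivrMr// ltr_pMr// ltr1n.
pose e (i : 'I_n) := cutoff_form c x (r / 2) (delta_mx 0 i).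
have near1 : \forall y \near x, forall i, fcomp c (e i) y = delta_mx 0 i.
  apply: (@filter_forall _ _ (fun (i : 'I_n) => [set y | fcomp c (e i) y = delta_mx 0 i]) (nbhs x)) => i.
  exact: (cutoff_form_near ac r20 rc').
have near2 := filterI near1 (open_nbhs_nbhs (conj (@cimg_open _ _ _ c) xc)).
pose A := [set y | (forall i, fcomp c (e i) y = delta_mx 0 i) /\ cimg c y].
have VA : A^° `<=` A by exact: interior_subset.
exists A^°, e; split.
- exact: open_interior.
- exact: near2.
- by move=> y /VA[].
- by move=> i; exact: (cutoff_form_smooth ac r20 rc').
- by move=> i y /VA[+ _]; apply.
Qed.

Lemma congr_antisym (R : comNzRingType) n (B S : 'M[R]_n) :
  S^T = - S -> (B^T *m S *m B)^T = - (B^T *m S *m B).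
Proof. by move=> Sa; rewrite !trmx_mul trmxK Sa mulNmx mulmxN mulmxA. Qed.

Lemma congr_sym (R : comNzRingType) n (A S : 'M[R]_n) :
  S^T = S -> (A *m S *m A^T)^T = A *m S *m A^T.
Proof. by move=> Ss; rewrite !trmx_mul trmxK Ss mulmxA. Qed.

(** At p itself the components in the chart at p are the given arrays, because the
    transition map is the identity; this is where the coordinate formulas of the
    Koszul bracket, the divergence and the Lie derivative apply. *)
Section at_a_point.
Context {R : realType} {n : nat} {M : manifold R n}.
Variables (g : metric_field M) (P : bivector_field M).
Variables (D : covector_field M -> covector_field M -> covector_field M).
Hypothesis gm : riemannian_metric g.
Hypothesis Ps : smooth_bivector_field P.
Hypothesis Dc : metric_contravariant_connection P g D.
Hypothesis DP : parallel_bivector P D.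
Variable p : M.
Local Notation c := (chart_at p).
Local Notation x := (cmap c p).
Variables (O : set 'rV[R]_n) (e : 'I_n -> covector_field M).
Hypotheses (oO : open O) (Ox : O x) (Oc : O `<=` cimg c).
Hypothesis es : forall i, smooth_one_form (e i).
Hypothesis eO : forall i y, O y -> fcomp c (e i) y = delta_mx 0 i.

Let ac : atlas c. Proof. exact: chart_at_atlas. Qed.
Let cp : cdom c p. Proof. exact: chart_at_dom. Qed.
Let J1 : transition_jacobian c c p = 1%:M.
Proof. exact: transition_jacobian_id. Qed.

Lemma fcomp_at al : fcomp c al x = al p.
Proof. by rewrite /fcomp cmapK// J1 trmx1 mulmx1. Qed.

Lemma vcomp_at (X : vector_field M) : vcomp c X x = X p.
Proof. by rewrite /vcomp cmapK// J1 mulmx1. Qed.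

Lemma bcomp_at : bcomp c P x = P p.
Proof. by rewrite /bcomp cmapK// J1 trmx1 mulmx1 mul1mx. Qed.

Lemma mcomp_at : mcomp c g x = g p.
Proof. by rewrite /mcomp cmapK// J1 trmx1 mulmx1 mul1mx. Qed.

Local Notation w := (bcomp c P).
Local Notation G := (fun y => invmx (mcomp c g y)).
Local Notation Gx := (invmx (mcomp c g x)).
Local Notation Gam a := (symbols D c e a x).

Let dw := smooth_entries_differentiable oO (w_smooth Ps ac Oc) Ox.

Lemma lie_frame a b k :
  lie_one_form (anchor P (e a)) (e b) p 0 k = mx_partial k w x a b.
Proof.
have -> : lie_one_form (anchor P (e a)) (e b) p =
    'D_(anchor P (e a) p) (fcomp c (e b)) x + e b p *m ('J (vcomp c (anchor P (e a))) x)^T.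
  by [].
have -> : 'D_(anchor P (e a) p) (fcomp c (e b)) x = 0.
  apply: etrans (derive_cst (delta_mx 0 b : 'rV[R]_n) x (anchor P (e a) p)).
  by apply: near_eq_derive; apply: near_open oO Ox _ => y Oy; rewrite eO.
have E j : forall y, O y -> w y a j = vcomp c (anchor P (e a)) y 0 j.
  by move=> y Oy; rewrite (frame_anchor P ac Oc eO a Oy) [RHS]mxE.
have dv : entries_differentiable (vcomp c (anchor P (e a))) x.
  move=> i j; rewrite (ord1 i).
  apply: (smooth_differentiable oO _ Ox).
  by apply: (smooth_eq_on oO (E j)); exact: (w_smooth Ps ac Oc).
rewrite add0r -fcomp_at eO// -rowE [LHS]mxE [LHS]mxE (jacobian_mx_partial dv).
rewrite [LHS]mxE [LHS]mxE [RHS]mxE; apply/esym; exact: (partial_eq_on k oO Ox (E b)).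
Qed.

Lemma bcomp_anti y : - w y = (w y)^T.
Proof. by apply/esym/congr_antisym; case: Ps => _; apply. Qed.

Lemma mcomp_sym y : (mcomp c g y)^T = mcomp c g y.
Proof. by apply: congr_sym; case: gm. Qed.

(** For forms with constant components, both Lie derivatives and the differential
    in the Koszul bracket are derivatives of the bivector, and
    dw + dw - dw remains. *)
Lemma local_torsion k a b : mx_partial k w x a b = Gam a b k - Gam b a k.
Proof.
apply: esym.
have H := mcc_torsion_free Dc (es a) (es b) p.
have S a' b' : Gam a' b' k = D (e a') (e b') p 0 k by rewrite mxE fcomp_at.
have sub2 (u v : 'rV[R]_n) : (u - v) 0 k = u 0 k - v 0 k by rewrite !mxE.
rewrite !S; apply: etrans (esym (sub2 _ _)) _; rewrite H.
apply: etrans (sub2 _ _) _; rewrite sub2.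
have dE : differential (bivector_pairing P (e a) (e b)) p 0 k = mx_partial k w x a b.
  rewrite [LHS]mxE [RHS]mxE; apply: (partial_eq_on k oO Ox) => y Oy.
  exact: (frame_pairing P ac Oc eO a b Oy).
transitivity (mx_partial k w x a b - mx_partial k w x b a - mx_partial k w x a b).
  by congr (_ - _ - _); [exact: lie_frame|exact: lie_frame|exact: dE].
have -> : mx_partial k w x b a = - mx_partial k w x a b.
  have : mx_partial k (fun y => - w y) x = mx_partial k (fun y => (w y)^T) x.
    exact: (congr1 (fun F => mx_partial k F x) (funext bcomp_anti)).
  rewrite mx_partial_tr => /matrixP/(_ a b); rewrite [in RHS]mxE => <-.
  rewrite [LHS]mxE [X in - X]mxE.
  transitivity (partial k (fun y => (-1) * w y a b) x).
    by congr (partial k _ x); apply/funext => y; rewrite mxE mulN1r.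
  rewrite (partialM k (differentiable_cst (-1 : R^o) x) (dw a b)).
  by rewrite partial_cst mulr0 addr0 mulN1r.
lra.
Qed.

Let wanti : (w x)^T = - w x.
Proof. by rewrite bcomp_at; case: Ps => _; apply. Qed.

Let gu := metric_unitmx gm p.

Let Gsym : Gx^T = G x.
Proof. by have [_ gs _] := gm; rewrite mcomp_at trmx_inv gs. Qed.

Let Gpos (a : 'rV[R]_n) : a != 0 -> 0 < form Gx a a.
Proof.
move=> a0; have := Gsym; rewrite mcomp_at => Gs.
have [_ _ /(_ p (a *m invmx (g p)))] := gm.
rewrite trmx_mul Gs (mulmxA (_ *m _ *m _)) mulmxKV//; apply.
by apply: contra_neq a0 => /(congr1 (mulmx^~ (g p))); rewrite mulmxKV// mul0mx.
Qed.

Let met := local_metric gm Dc ac oO Oc es eO.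
Let par := local_parallel Ps DP ac oO Oc es eO.
Let pard := local_parallel_deriv Ps Dc DP ac oO Oc es eO.

Lemma divergence_at : divergence g P p = 0.
Proof.
apply/rowP => j; rewrite [LHS]mxE [RHS]mxE.
have ms := m_smooth gm ac Oc.
have dg l : (mx_partial l (mcomp c g) x)^T = mx_partial l (mcomp c g) x.
  rewrite -mx_partial_tr; exact: (congr1 (fun F => mx_partial l F x) (funext mcomp_sym)).
have gG : mcomp c g x *m Gx = 1%:M by rewrite mulmxV// mcomp_at.
have := @divergence_eq0 R n (w x) Gx (mcomp c g x) (fun a => Gam a)
  (fun k => mx_partial k w x) (fun k => mx_partial k G x)
  (fun k => mx_partial k (mcomp c g) x) _ _ Gsym Gpos wanti local_torsion
  (fun a => met a Ox) (fun a => par a Ox) (fun i a => pard i a Ox) gG dg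
  (fun l => local_cometric_partial gm ac oO Oc l Ox) j.
rewrite mcomp_at bcomp_at => H; rewrite -[RHS]H; apply: eq_bigr => i _.
have dmE l a b : partial l (fun y => mcomp c g y a b) x = mx_partial l (mcomp c g) x a b.
  by apply/esym; exact: mxE.
have chrE k a b : christoffel g p k a b = 2^-1 * \sum_(l < n) invmx (g p) k l *
    (mx_partial a (mcomp c g) x b l + mx_partial b (mcomp c g) x a l
     - mx_partial l (mcomp c g) x a b).
  by congr (_ * _); apply: eq_bigr => l _; congr (_ * _); congr (_ + _ - _); exact: dmE.
congr (_ + _); first by apply/esym; exact: mxE.
by apply: eq_bigr => l _; congr (_ * _ + _ * _); exact: chrE.
Qed.

(** On the part of the frame's domain that lies over U, the differential phi of f
    satisfies phi *m w = 0; this identity is differentiated at p, and the gradient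
    has components phi *m G. *)
Lemma casimir_at (U : set M) (f : M -> R) : open U -> U p -> casimir_on P U f ->
  lie_bivector (gradient g f) P p = 0.
Proof.
move=> oU Up [sf cas].
pose O' := O `&` (cimg c `&` cinv c @^-1` U).
have oO' : open O' by apply: openI => //; exact: (@chart_preimage_open _ _ _ c U oU).
have Ox' : O' x by split=> //; split; [exact: Oc|rewrite /= cmapK].
have O'O : O' `<=` O by move=> y [].
have yU y : O' y -> U (cinv c y) by move=> [_ []].
pose F := f \o cinv c.
have sF : smooth_on O' F by apply: smooth_sub (sf _ ac) => y [].
pose phi y : 'rV[R]_n := \row_i partial i F y.
have phiE y : O' y -> fcomp c (differential f) y = phi y.
  by move=> Oy; exact: (fcomp_differential ac (Oc (O'O _ Oy)) oU (yU _ Oy) sf).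
have sphi : smooth_mx_on O' phi.
  move=> i j; rewrite (_ : (fun y => _) = partial j F); first exact: smooth_partial.
  by apply/funext => y; rewrite mxE.
have sw : smooth_mx_on O' w by move=> i j; apply: smooth_sub O'O (w_smooth Ps ac Oc i j).
have sG : smooth_mx_on O' G by move=> i j; apply: smooth_sub O'O (G_smooth gm ac oO Oc i j).
have dphi := smooth_entries_differentiable oO' sphi Ox'.
have dG := smooth_entries_differentiable oO' sG Ox'.
pose H : 'M[R]_n := \matrix_(k, l) partial k (partial l F) x.
have Hsym : H^T = H.
  apply/matrixP => k l; rewrite 3!mxE.
  exact: (partialC l k oO' Ox' (iffLR (smooth_onP _ _) sF 2%N)).
have rowH k : mx_partial k phi x = row k H.
  apply/rowP => l; rewrite 3!mxE; congr (partial k _ x).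
  by apply/funext => y; rewrite mxE.
have phiw y : O' y -> phi y *m w y = 0.
  move=> Oy; rewrite -phiE// -(vcomp_anchor ac (Oc (O'O _ Oy))) /vcomp cas ?mul0mx//.
  exact: yU.
have dphiw k : phi x *m mx_partial k w x + row k H *m w x = 0.
  rewrite -rowH addrC -(mx_partialM k dphi dw).
  by rewrite (mx_partial_eq_on k oO' Ox' phiw); exact: mx_partial_cst.
have gradE y : O' y -> phi y *m G y = vcomp c (gradient g f) y.
  move=> Oy; rewrite -phiE//.
  by rewrite (vcomp_gradient ac (Oc (O'O _ Oy)) f (metric_unitmx gm _)).
have dgrad : entries_differentiable (vcomp c (gradient g f)) x.
  apply: (smooth_entries_differentiable oO' _ Ox') => i j.
  apply: (smooth_eq_on oO' (f := fun y => (phi y *m G y) i j)).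
    by move=> y Oy; rewrite gradE.
  exact: smooth_mulmx.
have DX : 'J (vcomp c (gradient g f)) x =
    \matrix_k (phi x *m mx_partial k G x + row k H *m Gx).
  rewrite (jacobian_mx_partial dgrad); apply/row_matrixP => k; rewrite !rowK.
  rewrite -(mx_partial_eq_on k oO' Ox' gradE) (mx_partialM k dphi dG) rowH.
  exact: addrC.
have -> : lie_bivector (gradient g f) P p =
  'D_(gradient g f p) w x - ('J (vcomp c (gradient g f)) x)^T *m P p
   - P p *m 'J (vcomp c (gradient g f)) x by [].
rewrite DX (derive_mx_partial _ dw) -vcomp_at -gradE// -bcomp_at.
exact: (@casimir_gradient_preserves R n (w x) Gx (fun a => Gam a)
  (fun k => mx_partial k w x) (fun k => mx_partial k G x) _ _ Gpos wanti local_torsion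
  (fun a => met a Ox) (fun a => par a Ox) (fun i a => pard i a Ox) (phi x) H (phiw x Ox') Hsym dphiw).
Qed.

End at_a_point.

Theorem theorem1p3 (R : realType) (n : nat) (M : manifold R n)
    (g : metric_field M) (P : bivector_field M)
    (D : covector_field M -> covector_field M -> covector_field M) :
  riemannian_metric g ->
  poisson_tensor P ->
  metric_contravariant_connection P g D ->
  parallel_bivector P D ->
  killing_poisson P g.
Proof.
move=> gm Pp Dc DP; have [Ps _] := Pp.
split=> // [p|U f oU cas p Up].
  have [V [e [oV Vx Vc es eV]]] :=
    local_frame (chart_at_atlas p) (cmap_img (chart_at_dom p)).
  exact: (divergence_at gm Ps Dc DP oV Vx Vc es eV).
have [V [e [oV Vx Vc es eV]]] :=
  local_frame (chart_at_atlas p) (cmap_img (chart_at_dom p)).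
exact: (casimir_at gm Ps Dc DP oV Vx Vc es eV oU Up cas).
Qed.
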